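(* There exist absolute constants $c>0$ and $K_0$ such that for every $K\ge K_0$ and every metric space $M$ with more than $K$ points, every randomized online algorithm for the $K$-server problem on $M$ that is $r$-competitive against oblivious adversaries satisfies $r\ge c\,\frac{\log K}{(\log\log K)^2}$; i.e., the randomized competitive ratio is $\Omega(\log K/\log^2\log K)$.
   Context: $K$-server problem on a metric space $M$: $K$ mobile servers reside at points of $M$ (initial positions given). A sequence of requests, each a point of $M$, is presented; to serve a request some server must be moved to the requested point. The cost is the total distance travelled by the servers. An online algorithm serves each request before seeing the next. $\mathrm{cost}_{\mathrm{OPT}}(\sigma)$ is the minimum offline cost. A randomized online algorithm $A$ is $r$-competitive against oblivious adversaries if there is a constant $c'$ such that $\mathbb{E}[\mathrm{cost}_A(\sigma)]\le r\,\mathrm{cost}_{\mathrm{OPT}}(\sigma)+c'$ for every request sequence $\sigma$. *)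

(* Defs.v *)
From mathcomp Require Import all_boot all_order all_algebra.
From mathcomp Require Import all_classical all_reals all_analysis.

Set Implicit Arguments.
Unset Strict Implicit.
Unset Printing Implicit Defensive.

Import Order.TTheory GRing.Theory Num.Theory.

Local Open Scope classical_set_scope.
Local Open Scope ring_scope.

Section KServer.
Context {R : realType} {M : metricType R} {K : nat}.

(* Servers are labelled, and several of them may occupy the same point. *)
Definition config := 'I_K -> M.

(* [S t] is the configuration after the first [t] requests have been served.
   Any number of servers may move at each step. *)
Definition serves (x0 : config) (sigma : seq M) (S : nat -> config) : Prop :=
  S 0%N = x0 /\
  forall t x, onth sigma t = Some x -> exists i : 'I_K, S t.+1 i = x.

Definition movement_cost (n : nat) (S : nat -> config) : R :=
  \sum_(t < n) \sum_(i < K) mdist (S t i) (S t.+1 i).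

(* For 0 < K the set below is nonempty, and its infimum is a minimum: lazy
   schedules, which move only one server onto each request, are optimal and
   finite in number. *)
Definition cost_opt (x0 : config) (sigma : seq M) : R :=
  inf [set movement_cost (size sigma) S | S in serves x0 sigma].

(* An online algorithm maps the requests seen so far to a configuration. *)
Definition online_schedule (A : seq M -> config) (sigma : seq M) :
    nat -> config :=
  fun t => A (take t sigma).

Definition is_online_algorithm (x0 : config) (A : seq M -> config) : Prop :=
  forall sigma, serves x0 sigma (online_schedule A sigma).

Definition cost_alg (A : seq M -> config) (sigma : seq M) : R :=
  movement_cost (size sigma) (online_schedule A sigma).

(* A randomized algorithm is a random deterministic online algorithm over some
   probability space. Measurability is only required of the costs, so that
   their expectations make sense. *)
Definition is_randomized_algorithm d (T : measurableType d)
    (x0 : config) (A : T -> seq M -> config) : Prop :=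
  (forall w, is_online_algorithm x0 (A w)) /\
  (forall sigma, measurable_fun [set: T] (fun w => cost_alg (A w) sigma)).

(* The adversary is oblivious: [sigma] does not depend on [w]. *)
Definition competitive d (T : measurableType d) (P : probability T R)
    (x0 : config) (A : T -> seq M -> config) (r : R) : Prop :=
  exists c' : R, forall sigma : seq M,
    ('E_P[fun w => cost_alg (A w) sigma]
       <= (r * cost_opt x0 sigma + c')%:E)%E.

End KServer.

Arguments config {R} M K.

(* Main.v *)
(* Fix [K + 1] points of [M]. A configuration leaves at least one of them uncovered,
   the hole, and a request at the hole forces it to move: the servers problem becomes
   the problem of moving a hole away from random requests, and by Yao's principle it
   suffices to find a random sequence that is expensive for every online hole but
   cheap for one that knows the sequence. Optimal online costs are given by backward
   induction ([value]), and a block of requests in [Z] is summarised by the cost it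
   forces inside [Z] when leaving [Z] is expensive ([forces]).

   Cut [M] into a hierarchy of separated clusters, at scales [d0 * 2 ^ l]. If the
   children of a cluster force ratios [rate * ln n_j], then the cluster forces
   [rate * ln (sum n_j)]. When many children have comparable sizes this is shown by
   requesting random halves of them, and the gain comes from the fluctuations of
   random walks. When one child dominates, it is combined with the second largest one
   alone: by a long run on the larger child if the second ratio is small, and by a
   biased gambler's ruin otherwise. Such a step needs exit costs that are large
   compared with those of the children, so it is performed only at every [h]-th level,
   [h] of order [ln ln K]; there are [h] choices of the residue, and the ball cutting
   loses little enough for the product of the [h] resulting sizes to be at least
   [sqrt K]. Hence some residue reaches size [K ^ (1 / (2 h))] and ratio of order
   [ln K / ln ln K], which beats the claim. *)

Require Import Defs.
From mathcomp Require Import all_boot all_order all_algebra.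
From mathcomp Require Import all_classical all_reals all_analysis.
From mathcomp Require Import perm measurable_realfun.
From mathcomp Require Import ring lra zify.

Set Implicit Arguments.
Unset Strict Implicit.
Unset Printing Implicit Defensive.

Import Order.TTheory GRing.Theory Num.Theory.

Local Open Scope ring_scope.

(** * Random request sequences *)

Section Adversaries.
Context {R : realType}.

(** Random sequences are finite trees, so expectations and backward induction are structural
    recursions; an integral occurs only where the coins of the algorithm are averaged. The obstacle
    is that an online hole may flee from a block. Hence [forces] quantifies over every terminal
    price and every ambient set, under a hypothesis on the price of leaving: this lets blocks be
    concatenated and nested. That price has to exceed whatever the rest of the game can still force.
    With ratio [r] and separation [delta], the games below force totals of order up to
    [r ^ 2 * delta], and [r] may reach the order of [ln K]; so the exit cost of a node exceeds its
    separation by a factor of order up to [ln K ^ 2] ([overhead]), and the scale must grow by that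
    factor before the node can serve as a child. This is where [h] of order [ln ln K] comes from.
    All games rest on one principle: online, every child is charged the same expected amount, so
    nothing is gained by moving, whereas the offline hole selects its child after seeing the
    outcome. *)

Inductive adversary (X : Type) :=
| Stop
| Request of X & adversary X
| Coin of R & adversary X & adversary X.
Arguments Stop {X}.

Section OneAlphabet.
Context {X : Type}.
Implicit Types (a b : adversary X) (F G : seq X -> R).

Fixpoint andthen a b :=
  match a with
  | Stop => b
  | Request x a' => Request x (andthen a' b)
  | Coin p a1 a2 => Coin p (andthen a1 b) (andthen a2 b)
  end.

Fixpoint mean a F : R :=
  match a with
  | Stop => F [::]
  | Request x a' => mean a' (fun s => F (x :: s))
  | Coin p a1 a2 => p * mean a1 F + (1 - p) * mean a2 F
  end.

Fixpoint fair_on (Q : X -> Prop) a : Prop :=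
  match a with
  | Stop => True
  | Request x a' => Q x /\ fair_on Q a'
  | Coin p a1 a2 => [/\ 0 <= p <= 1, fair_on Q a1 & fair_on Q a2]
  end.

Lemma fair_on_sub (Q Q' : X -> Prop) a :
  (forall x, Q x -> Q' x) -> fair_on Q a -> fair_on Q' a.
Proof.
move=> QQ'; elim: a => //= [x a IH [/QQ' ? /IH ?]//|p a IHa b IHb [? /IHa ? /IHb ?]].
by split.
Qed.

Lemma fair_on_andthen (Q : X -> Prop) a b :
  fair_on Q a -> fair_on Q b -> fair_on Q (andthen a b).
Proof.
move=> + fb; elim: a => //= [x a IH [? /IH ?]//|p a1 IH1 a2 IH2 [? /IH1 ? /IH2 ?]].
by split.
Qed.

Lemma eq_mean a F G : F =1 G -> mean a F = mean a G.
Proof.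
elim: a F G => /= [|x a IH|p a IHa b IHb] F G FG; first exact: FG.
  by apply: IH => s; exact: FG.
by rewrite (IHa _ G) // (IHb _ G).
Qed.

Lemma le_mean (Q : X -> Prop) a F G : fair_on Q a ->
  (forall s, F s <= G s) -> mean a F <= mean a G.
Proof.
elim: a F G => /= [|x a IH|p a IHa b IHb] F G //.
- by move=> [_ fa] FG; apply: IH.
- move=> [/andP[p0 p1] fa fb] FG.
  by rewrite lerD // ler_wpM2l ?subr_ge0 ?IHa ?IHb.
Qed.

Lemma meanD a F G : mean a (fun s => F s + G s) = mean a F + mean a G.
Proof.
elim: a F G => //= p a IHa b IHb F G.
by rewrite IHa IHb; ring.
Qed.

Lemma meanZ a c F : mean a (fun s => c * F s) = c * mean a F.
Proof.
elim: a F => //= p a IHa b IHb F.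
by rewrite IHa IHb; ring.
Qed.

Lemma mean_cst a c : mean a (fun _ => c) = c.
Proof. by elim: a => //= p a -> b ->; ring. Qed.

Lemma mean_sum (I : Type) (r : seq I) a (F : I -> seq X -> R) :
  mean a (fun s => \sum_(i <- r) F i s) = \sum_(i <- r) mean a (F i).
Proof.
elim: r => [|i r IH].
  by rewrite big_nil -[RHS](mean_cst a 0); apply: eq_mean => s; rewrite big_nil.
rewrite big_cons -IH -meanD; apply: eq_mean => s.
by rewrite big_cons.
Qed.

Lemma mean_andthen a b F :
  mean (andthen a b) F = mean a (fun s => mean b (fun t => F (s ++ t))).
Proof. by elim: a F => //= p a1 IH1 a2 IH2 F; rewrite IH1 IH2. Qed.

End OneAlphabet.

Lemma mean_swap (X Z : Type) (a : adversary X) (b : adversary Z) F :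
  mean a (fun s => mean b (F s)) = mean b (fun t => mean a (F^~ t)).
Proof.
elim: a F => //= p a1 IH1 a2 IH2 F.
rewrite IH1 IH2 -!meanZ -meanD.
by apply: eq_mean.
Qed.

Section Expansion.
Context {X Z : Type} (f : X -> adversary Z).

Definition play (s : seq X) : adversary Z := foldr (fun x => andthen (f x)) Stop s.

Fixpoint expand (a : adversary X) : adversary Z :=
  match a with
  | Stop => Stop
  | Request x a' => andthen (f x) (expand a')
  | Coin p a1 a2 => Coin p (expand a1) (expand a2)
  end.

(** Each occurrence of a letter gets fresh coins, independent of those of [a], so the word over [X]
    may be drawn first and its letters played afterwards. Offline estimates condition on that
    word. *)
Lemma mean_expand a F : mean (expand a) F = mean a (fun s => mean (play s) F).
Proof.
elim: a F => //= [x a IH F|p a1 IH1 a2 IH2 F]; last by rewrite IH1 IH2.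
rewrite mean_andthen (eq_mean _ (fun s => IH _)) mean_swap.
by apply: eq_mean => s; rewrite mean_andthen.
Qed.

Lemma fair_on_play (Q : Z -> Prop) s :
  (forall x, fair_on Q (f x)) -> fair_on Q (play s).
Proof. by move=> fQ; elim: s => //= x s IH; exact: fair_on_andthen. Qed.

Lemma fair_on_expand (P : X -> Prop) (Q : Z -> Prop) a :
  (forall x, P x -> fair_on Q (f x)) -> fair_on P a -> fair_on Q (expand a).
Proof.
move=> fQ; elim: a => //= [x a IH [Px /IH ?]|p a1 IH1 a2 IH2 [? /IH1 ? /IH2 ?]].
  by apply: fair_on_andthen => //; exact: fQ.
by split.
Qed.

End Expansion.
End Adversaries.
Arguments Stop {R X}.
Arguments adversary R X : clear implicits.

Record is_metric (R : realType) (T : finType) (d : T -> T -> R) : Prop := {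
  dist_xx : forall x, d x x = 0;
  dist_sym : forall x y, d x y = d y x;
  dist_tri : forall y x z, d x z <= d x y + d y z;
  dist_gt0 : forall x y, x != y -> 0 < d x y }.

(** * The hole game on a finite metric space *)

Section HoleGame.
Context {R : realType} {T : finType} (d : T -> T -> R) (dM : is_metric d).
Implicit Types (Y Z : {set T}) (a : adversary R T) (w : T -> R).

Let dxx := dist_xx dM.
Let dC := dist_sym dM.
Let dtri := dist_tri dM.

Lemma dist_ge0 x y : 0 <= d x y.
Proof. have := dtri y x x; rewrite dxx (dC y x); lra. Qed.

(* Junk value 0 when no point of [Y] other than [x] is left. *)
Definition nearest Y (x : T) w (z : T) : R :=
  if [pick u in Y :\ x] is Some u0 then
    let u := [arg min_(u < u0 in Y :\ x) (w u + d u z)]%O in w u + d u z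
  else 0.

Lemma nearest_le Y x w z u : u \in Y :\ x -> nearest Y x w z <= w u + d u z.
Proof.
move=> uY; rewrite /nearest; case: pickP => [u0 u0Y|/(_ u)]; last by rewrite uY.
by case: arg_minP => // v vY; apply.
Qed.

Lemma nearestP Y x w z : (1 < #|Y|)%N ->
  exists2 u, u \in Y :\ x & nearest Y x w z = w u + d u z.
Proof.
move=> Y1; rewrite /nearest; case: pickP => [u0 u0Y|Y0].
  by case: arg_minP => // v vY _; exists v.
have this : #|Y :\ x| = 0%N by apply: eq_card0.
by move: Y1; rewrite (cardsD1 x) this; case: (x \in Y).
Qed.

Lemma le_nearest Y x w z c : (1 < #|Y|)%N ->
  (forall u, u \in Y :\ x -> c <= w u + d u z) -> c <= nearest Y x w z.
Proof. by move=> Y1 h; have [u uY ->] := nearestP x w z Y1; exact: h. Qed.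

(* The hole is the point of the metric space left uncovered by the servers.
   [value Y a w] is the optimal expected cost, as a function of the current
   hole, of moving a hole inside [Y] away from each point requested by [a] and
   then paying the terminal price [w]. *)
Fixpoint value Y a w : T -> R :=
  match a with
  | Stop => w
  | Request x a' => fun z => if z == x then nearest Y x (value Y a' w) x
                             else value Y a' w z
  | Coin p a1 a2 => fun z => p * value Y a1 w z + (1 - p) * value Y a2 w z
  end.

(* Cost of the cheapest trajectory of the hole from [h] to [h'] when the
   requests [s] are known in advance. *)
Fixpoint offline Y (s : seq T) (h h' : T) : R :=
  match s with
  | [::] => d h h'
  | x :: s' => nearest Y x (fun g => offline Y s' g h') h
  end.

Lemma value_andthen Y a b w : value Y (andthen a b) w = value Y a (value Y b w).
Proof. by elim: a => //= [x a ->|p a1 -> a2 ->]. Qed.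

Lemma value_out Y Z a w z : fair_on (fun x => x \in Z) a -> z \notin Z ->
  value Y a w z = w z.
Proof.
move=> + zZ; elim: a => //= [x a IH [xZ /IH ->]|p a1 IH1 a2 IH2 [_ /IH1 -> /IH2 ->]].
  by case: eqP => // zx; rewrite zx xZ in zZ.
by ring.
Qed.

Lemma offline_lip Y s h g h' : (1 < #|Y|)%N ->
  offline Y s h h' <= d h g + offline Y s g h'.
Proof.
move=> Y1; case: s => [|x s] /=; first exact: dtri.
have [u uY ->] := nearestP x (fun g0 => offline Y s g0 h') g Y1.
apply: (le_trans (nearest_le _ _ uY)).
have := dtri g u h; rewrite (dC g h); lra.
Qed.

Lemma offline_cat Y s t h g h' : (1 < #|Y|)%N ->
  offline Y (s ++ t) h h' <= offline Y s h g + offline Y t g h'.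
Proof.
move=> Y1; elim: s h => [|x s IH] h /=; first exact: offline_lip.
have [u uY ->] := nearestP x (fun g0 => offline Y s g0 g) h Y1.
apply: (le_trans (nearest_le _ _ uY)).
by rewrite addrAC lerD2r.
Qed.

Definition mean_offline Y a h h' : R := mean a (fun s => offline Y s h h').

Lemma mean_offline_andthen Y Z a b h g h' : (1 < #|Y|)%N ->
  fair_on (fun x => x \in Z) a -> fair_on (fun x => x \in Z) b ->
  mean_offline Y (andthen a b) h h' <= mean_offline Y a h g + mean_offline Y b g h'.
Proof.
move=> Y1 fa fb; rewrite /mean_offline mean_andthen.
have -> : mean b (fun s => offline Y s g h') =
          mean a (fun _ => mean b (fun s => offline Y s g h')) by rewrite mean_cst.
rewrite -meanD; apply: (le_mean fa) => s.
rewrite -[X in X + _](mean_cst b) -meanD; apply: (le_mean fb) => t.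
exact: offline_cat.
Qed.

Lemma mean_offline_stay Y Z a h : h \in Y -> h \notin Z ->
  fair_on (fun x => x \in Z) a -> mean_offline Y a h h <= 0.
Proof.
rewrite /mean_offline => hY hZ; elim: a => /= [_|x a IH [xZ fa]|p a1 IH1 a2 IH2].
- by rewrite dxx.
- apply: le_trans (IH fa); apply: (le_mean fa) => s.
  rewrite -[leRHS]addr0 -[X in _ <= _ + X](dxx h).
  apply: (@nearest_le Y x (fun g => offline Y s g h)); rewrite !inE hY andbT.
  by apply: contraNneq hZ => ->.
- move=> [/andP[p0 p1] /IH1 h1 /IH2 h2].
  by rewrite -[0]addr0 lerD // mulr_ge0_le0 ?subr_ge0.
Qed.

(* [a] makes the hole pay [A] in expectation for staying in [Z], provided that
   leaving [Z] costs at least [E]. *)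
Definition forces Z a (A E : R) : Prop :=
  forall Y w m, Z \subset Y -> (1 < #|Y|)%N ->
    (forall u, u \in Z -> m <= w u) ->
    (forall x u, x \in Z -> u \in Y -> u \notin Z -> m + E <= w u + d u x) ->
    forall x, x \in Z -> m + A <= value Y a w x.

Definition block Z h a (A D E : R) : Prop :=
  [/\ h \in Z, fair_on (fun x => x \in Z) a,
      (forall Y, Z \subset Y -> (1 < #|Y|)%N -> mean_offline Y a h h <= D) &
      forces Z a A E].

(** Every budget [eps] is required so that a parent can adapt the blocks of its children to its own
    separation. The exit cost contains [r * eps] because leaving must stay unattractive while that
    much can still be charged inside. *)
Definition ratio_on Z h (r e : R) : Prop :=
  (1 < #|Z|)%N /\ forall eps, 0 < eps -> exists a, block Z h a (r * eps) eps (e + r * eps).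

Lemma le_ratio_on Z h (r e e' : R) : e <= e' -> ratio_on Z h r e -> ratio_on Z h r e'.
Proof.
move=> ee' [Z1 rZ]; split=> // eps eps0; have [a [hZ fa Da Fa]] := rZ eps eps0.
exists a; split=> //.
move=> Y w m ZY Y1 inZ outZ; apply: Fa => // x u xZ uY uZ.
by apply: le_trans (outZ _ _ xZ uY uZ); rewrite lerD2l lerD2r.
Qed.

Fixpoint repeat (k : nat) a : adversary R T :=
  if k is k'.+1 then andthen a (repeat k' a) else Stop.

(** Seen from the first copy, the remaining ones raise the terminal price inside [Z] and leave it
    unchanged outside; the exit cost has to cover that rise. *)
Lemma block_repeat Z h a (A D E : R) k : 0 <= A -> block Z h a A D E ->
  block Z h (repeat k a) (A *+ k) (D *+ k) (E + A *+ k).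
Proof.
move=> A0 [hZ fa Da Fa]; elim: k => [|k [_ fk Dk Fk]] /=.
  split=> // [Y _ Y1|Y w m _ _ inZ _ x xZ].
    by rewrite /mean_offline /= dxx mulr0n.
  by rewrite /= mulr0n addr0 inZ.
split=> // [|Y ZY Y1|Y w m ZY Y1 inZ outZ x xZ].
- exact: fair_on_andthen.
- rewrite mulrS; apply: le_trans (mean_offline_andthen h h h Y1 fa fk) _.
  by rewrite lerD ?Da ?Dk.
- have Ak : A *+ k.+1 = A *+ k + A by rewrite mulrSr.
  rewrite value_andthen Ak addrA; apply: Fa => // [u uZ|x' u x'Z uY uZ].
    apply: Fk => // x' u' x'Z u'Y u'Z.
    by apply: le_trans (outZ _ _ x'Z u'Y u'Z); rewrite Ak; lra.
  rewrite (value_out _ _ fk uZ); apply: le_trans (outZ _ _ x'Z uY uZ).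
  by rewrite Ak; lra.
Qed.

Lemma block_dilute Z h a (A D E f : R) : 0 <= f <= 1 -> block Z h a A D E ->
  block Z h (Coin f a Stop) (f * A) (f * D) E.
Proof.
move=> /andP[f0 f1] [hZ fa Da Fa]; split=> //= [|Y ZY Y1|Y w m ZY Y1 inZ outZ x xZ].
- by split=> //; rewrite f0.
- rewrite /mean_offline /= dxx mulr0 addr0 ler_wpM2l //.
  exact: Da.
- have : f * (m + A) <= f * value Y a w x by rewrite ler_wpM2l // Fa.
  have : (1 - f) * m <= (1 - f) * w x by rewrite ler_wpM2l ?subr_ge0 ?inZ.
  rewrite /=; lra.
Qed.

(** The target [r * eps] is filled with [s = r * eps / A] copies, a real number: the integer part by
    repetition, the fractional part by one copy played with that probability. *)
Lemma block_ratio_on Z h a (A D E r : R) : (1 < #|Z|)%N -> 0 < A -> 0 < r -> r * D <= A ->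
  block Z h a A D E -> ratio_on Z h r E.
Proof.
move=> Z1 A0 r0 rD Ba; split=> // eps eps0.
have s0 : 0 <= r * eps / A by rewrite divr_ge0 ?mulr_ge0 // ltW.
set s := r * eps / A in s0 *.
have := truncn_itv s0; set k := Num.truncn s => /andP[ks sk].
have sk' : s - k%:R <= 1 by rewrite -natr1 in sk; lra.
have f01 : 0 <= s - k%:R <= 1 by rewrite subr_ge0 ks.
have [hZ ff Df Ff] := block_dilute f01 Ba.
have [_ fk Dk Fk] := block_repeat k (ltW A0) Ba.
have sA : s * A = r * eps by rewrite /s divfK // gt_eqF.
have sD : s * D <= eps.
  have : s * (r * D) <= s * A by rewrite ler_wpM2l.
  by rewrite sA mulrCA ler_pM2l.
have kA : A *+ k = k%:R * A by rewrite mulr_natl.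
have kD : D *+ k = k%:R * D by rewrite mulr_natl.
exists (andthen (Coin (s - k%:R) a Stop) (repeat k a)); split=> //.
- exact: fair_on_andthen.
- move=> Y ZY Y1; apply: le_trans (mean_offline_andthen h h h Y1 ff fk) _.
  apply: le_trans (lerD (Df _ ZY Y1) (Dk _ ZY Y1)) _.
  by rewrite kD; lra.
- have le_kA : k%:R * A <= r * eps by rewrite -sA ler_pM2r.
  move=> Y w m ZY Y1 inZ outZ x xZ; rewrite value_andthen -sA.
  have -> : m + s * A = m + A *+ k + (s - k%:R) * A by rewrite kA; ring.
  apply: Ff => // [u uZ|x' u x'Z uY uZ].
    apply: Fk => // x' u' x'Z u'Y u'Z.
    by apply: le_trans (outZ _ _ x'Z u'Y u'Z); rewrite kA; lra.
  rewrite (value_out _ _ fk uZ); apply: le_trans (outZ _ _ x'Z uY uZ).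
  by rewrite kA; lra.
Qed.

Lemma offline_point x h (D : R) Y : h != x -> d x h *+ 2 <= D ->
  h \in Y -> x \in Y -> mean_offline Y (Request x Stop) x x <= D.
Proof.
move=> hx hD hY xY; apply: le_trans hD; rewrite /mean_offline /= mulr2n.
rewrite (dC x h).
by apply: (@nearest_le Y x (d^~ x)); rewrite !inE hx.
Qed.

Lemma forces_point x (A : R) : forces [set x] (Request x Stop) A A.
Proof.
move=> Y w m xY Y1 inZ outZ z; rewrite inE => /eqP ->.
rewrite /= eqxx; apply: le_nearest => // u; rewrite !inE => /andP[ux uY].
by apply: outZ; rewrite ?inE.
Qed.

End HoleGame.

(** * Composing the blocks of well separated children *)

Section Node.
Context {R : realType} {T : finType} (d : T -> T -> R) (dM : is_metric d).
Context {I : finType} (Z : I -> {set T}) (h : I -> T) (f : I -> adversary R T).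
Context (A eps : I -> R) (delta : R) (delta0 : 0 < delta).
Context (sepZ : forall i j x y, i != j -> x \in Z i -> y \in Z j -> delta <= d x y).
Context (hZ : forall i, h i \in Z i).
Context (fZ : forall i, fair_on (fun x => x \in Z i) (f i)).
Context (A_ge0 : forall i, 0 <= A i).
Context (Af : forall i, forces d (Z i) (f i) (A i) delta).

Definition node_union : {set T} := (\bigcup_(i : I) Z i)%SET.
Local Notation V := node_union.

Lemma in_node_union i x : x \in Z i -> x \in V.
Proof. by move=> xZ; apply/finset.bigcupP; exists i. Qed.

Lemma disjoint_children i j x : x \in Z i -> x \in Z j -> i = j.
Proof.
move=> xi xj; apply/eqP; apply: contraTT delta0 => ij.
by rewrite -leNgt -(dist_xx dM x); exact: (sepZ ij).
Qed.

Lemma node_union_card (i j : I) : i != j -> (1 < #|V|)%N.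
Proof.
move=> ij; apply/card_gt1P; exists (h i), (h j); split; [exact: in_node_union (hZ i)|exact: in_node_union (hZ j)|].
by apply: contra_neq ij => hij; apply: (@disjoint_children i j (h i)); rewrite // hij.
Qed.

Lemma fair_on_child i : fair_on (fun x => x \in V) (f i).
Proof. by apply: fair_on_sub (fZ i) => x; exact: in_node_union. Qed.

(** Fleeing to a sibling costs the separation, and later blocks never bring a price below [m]. By
    [uniq] the block of [j] only has to start from the baseline [m] inside [Z j], so exit cost
    [delta] is enough for each block, however long [s] is. *)
Lemma play_value (Y : {set T}) w (m : R) (s : seq I) i x : V \subset Y -> (1 < #|Y|)%N -> uniq s ->
  (forall u, u \in V -> m <= w u) ->
  (forall x u, x \in V -> u \in Y -> u \notin V -> m + delta <= w u + d u x) ->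
  x \in Z i -> m + A i *+ (i \in s) <= value d Y (play f s) w x.
Proof.
move=> VY Y1 + inV outV; elim: s i x => [i x _ xZ|j s IH i x /=/andP[js us] xZ].
  by rewrite in_nil mulr0n addr0 inV // (in_node_union xZ).
rewrite value_andthen inE; have [ij|ij] /= := eqVneq i j; last first.
  rewrite (value_out d _ _ (fZ j)) ?IH //.
  by apply: contra_neqN ij => xj; exact: disjoint_children xZ xj.
rewrite mulr1n -ij; apply: Af => // [|u uZ|x' u x'Z uY uZ].
- by apply: fintype.subset_trans VY; apply/fintype.subsetP => y; exact: in_node_union.
- by apply: le_trans (IH i u us uZ); rewrite ij (negPf js) mulr0n addr0.
have [uV|uV] := boolP (u \in V).
  have [k _ uk] := finset.bigcupP uV.
  apply: lerD; first by apply: le_trans (IH k u us uk); rewrite lerDl mulrn_wge0.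
  by apply: (@sepZ k i) => //; apply: contraNneq uZ => <-.
rewrite (value_out d _ _ _ uV); first by apply: outV => //; exact: in_node_union x'Z.
exact/fair_on_play/fair_on_child.
Qed.

Context {L : Type} (J : L -> seq I) (J_uniq : forall l, uniq (J l)).

(** A certificate for backward induction in which the future gain is one number, the same for all
    children. Moving between children then brings nothing, and the inequality has to hold only for
    each fixed child [i]. [G] bounds the gains of the subtrees, whence the exit cost [G + delta] of
    the expanded game. *)
Inductive gain (G : R) : adversary R L -> R -> Prop :=
| GainStop g : g <= 0 -> gain G Stop g
| GainCoin p l1 t1 g1 l2 t2 g2 g : 0 <= p <= 1 ->
    gain G t1 g1 -> gain G t2 g2 -> g1 <= G -> g2 <= G ->
    (forall i, g <= p * (g1 + A i *+ (i \in J l1)) +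
                    (1 - p) * (g2 + A i *+ (i \in J l2))) ->
    gain G (Coin p (Request l1 t1) (Request l2 t2)) g.

Definition play_letter (l : L) : adversary R T := play f (J l).

Lemma fair_on_expand_letters t : fair_on (fun _ => True) t ->
  fair_on (fun x => x \in V) (expand play_letter t).
Proof.
apply: fair_on_expand => l _.
exact/fair_on_play/fair_on_child.
Qed.

Lemma gain_fair G t g : gain G t g -> fair_on (fun _ => True) t.
Proof. by elim=> //= p l1 t1 g1 l2 t2 g2 g' p01 _ f1 _ f2 *; split. Qed.

Lemma gain_forces G t g : gain G t g ->
  forces d V (expand play_letter t) g (G + delta).
Proof.
elim=> [g0 g0_le0|p l1 t1 g1 l2 t2 g2 g' p01 gt1 IH1 gt2 IH2 g1G g2G gle] Y w m VY Y1 inV outV x xV.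
  by rewrite /=; have := inV x xV; lra.
have [i _ xi] := finset.bigcupP xV.
have step gk tk lk : gain G tk gk -> forces d V (expand play_letter tk) gk (G + delta) -> gk <= G ->
    m + gk + A i *+ (i \in J lk) <= value d Y (expand play_letter (Request lk tk)) w x.
  move=> gtk IHk gkG; rewrite /= value_andthen; apply: play_value => //.
    by move=> u uV; apply: IHk.
  move=> x' u x'V uY uV; rewrite (value_out d _ _ _ uV); last first.
    exact/fair_on_expand_letters/(gain_fair gtk).
  by apply: le_trans (outV _ _ x'V uY uV); lra.
have {step} := (step g1 t1 l1 gt1 IH1 g1G, step g2 t2 l2 gt2 IH2 g2G).
move=> [s1 s2]; move: p01 => /andP[p0 p1].
have := ler_wpM2l p0 s1; have := @ler_wpM2l _ (1 - p) _ _ _ s2.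
rewrite subr_ge0 => /(_ p1); have := gle i; rewrite /=; lra.
Qed.

Lemma play_offline (Y : {set T}) i (s : seq I) : V \subset Y -> (1 < #|Y|)%N ->
  mean_offline d Y (f i) (h i) (h i) <= eps i ->
  mean_offline d Y (play f s) (h i) (h i) <= eps i *+ count_mem i s.
Proof.
move=> VY Y1 epsi; elim: s => [|j s IH] /=.
  by rewrite /mean_offline /= (dist_xx dM) mulr0n.
apply: le_trans (mean_offline_andthen dM (h i) (h i) (h i) Y1 (fair_on_child j) _) _.
  exact/fair_on_play/fair_on_child.
rewrite mulrnDr lerD //; have [ji|ij] := eqVneq j i; first by rewrite mulr1n ji.
rewrite mulr0n; apply: (mean_offline_stay dM) (fZ j).
- exact/(fintype.subsetP VY)/(in_node_union (hZ i)).
- by apply: contra_neqN ij => /disjoint_children/(_ (hZ i)).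
Qed.

Lemma play_letters_offline (Y : {set T}) i (s : seq L) : V \subset Y -> (1 < #|Y|)%N ->
  mean_offline d Y (f i) (h i) (h i) <= eps i ->
  mean_offline d Y (play play_letter s) (h i) (h i)
    <= eps i *+ count (fun l => i \in J l) s.
Proof.
move=> VY Y1 epsi; elim: s => [|l s IH] /=.
  by rewrite /mean_offline /= (dist_xx dM) mulr0n.
have fV l' : fair_on (fun x => x \in V) (play_letter l').
  exact/fair_on_play/fair_on_child.
apply: le_trans (mean_offline_andthen dM (h i) (h i) (h i) Y1 (fV l) _) _.
  exact: fair_on_play.
by rewrite mulrnDr lerD // -count_uniq_mem // play_offline.
Qed.

(** The child [i] may depend on the outcome [s]: the offline hole travels from [h i0] to the child
    that is best for [s], keeps returning to [h i] throughout, and goes back at the end, which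
    accounts for the doubled distance. *)
Lemma node_block G t g i0 (c : seq L -> R) :
  (forall i (Y : {set T}), V \subset Y -> (1 < #|Y|)%N ->
     mean_offline d Y (f i) (h i) (h i) <= eps i) ->
  gain G t g ->
  (forall s, exists i, d (h i0) (h i) *+ 2 + eps i *+ count (fun l => i \in J l) s <= c s) ->
  block d V (h i0) (expand play_letter t) g (mean t c) (G + delta).
Proof.
move=> epsf gt cP; split.
- exact: in_node_union (hZ i0).
- exact/fair_on_expand_letters/(gain_fair gt).
- move=> Y VY Y1; rewrite /mean_offline mean_expand.
  apply: (le_mean (gain_fair gt)) => s; have [i] := cP s; apply: le_trans.
  have fs : fair_on (fun x => x \in V) (play play_letter s).
    by apply: fair_on_play => l; exact/fair_on_play/fair_on_child.
  apply: le_trans (_ : d (h i0) (h i) *+ 2 + mean_offline d Y (play play_letter s) (h i) (h i) <= _); last first.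
    by rewrite lerD2l play_letters_offline // epsf.
  rewrite -[X in X + _](mean_cst (play play_letter s)) /mean_offline -meanD.
  apply: (le_mean fs) => u; rewrite mulr2n -addrA.
  apply: le_trans (offline_lip dM u (h i0) (h i) (h i0) Y1) _.
  rewrite lerD2l -{1}[u]cats0.
  apply: le_trans (offline_cat dM u [::] (h i) (h i) (h i0) Y1) _.
  by rewrite /= (dist_sym dM (h i)) addrC.
- exact: gain_forces.
Qed.

End Node.

(** * Three games on the children *)

Section Games.
Context {R : realType}.

(** * Halving game: random halves of [2 ^ q] comparable children *)

Section Halving.
Context {q : nat}.
Local Notation I := {ffun 'I_q -> bool}.
Local Notation L := ('I_q * bool)%type.

(* The children are indexed by [q]-bit words; the letter [(l, b)] stands for playing
   one block in each child whose [l]-th bit is [b]. *)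
Definition half (l : L) : seq I := enum [pred i : I | i l.1 == l.2].

Lemma mem_half i l : (i \in half l) = (i l.1 == l.2).
Proof. by rewrite mem_enum inE. Qed.

Fixpoint halving_tree (ls : seq 'I_q) : adversary R L :=
  if ls is l :: ls' then
    Coin 2^-1 (Request (l, true) (halving_tree ls')) (Request (l, false) (halving_tree ls'))
  else Stop.

(** Every child lies in exactly one of the two halves of a coordinate, so each coin forces [A / 2]
    wherever the hole is. *)
Lemma halving_gain (A G : R) (ls : seq 'I_q) : 0 <= A -> (size ls)%:R * (A / 2) <= G ->
  gain (fun=> A) half G (halving_tree ls) ((size ls)%:R * (A / 2)).
Proof.
move=> A0; elim: ls => [|l ls IH] /= lsG; first by apply: GainStop; rewrite mul0r.
have le_lsG : (size ls)%:R * (A / 2) <= G.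
  by apply: le_trans lsG; rewrite ler_wpM2r ?divr_ge0 // ler_nat.
apply: (GainCoin (g1 := (size ls)%:R * (A / 2)) (g2 := (size ls)%:R * (A / 2))).
- by apply/andP; split; lra.
- exact: IH.
- exact: IH.
- by [].
- by [].
- move=> i; rewrite !mem_half /= -natr1; case: (i l) => /=; lra.
Qed.

Definition imbalance (l : 'I_q) (s : seq L) : R :=
  (count_mem (l, true) s)%:R - (count_mem (l, false) s)%:R.

Lemma imbalance_cons l l' b s : imbalance l ((l', b) :: s) =
  (if l' == l then if b then 1 else -1 else 0) + imbalance l s.
Proof.
rewrite /imbalance /= !xpair_eqE.
by case: eqP => _; case: b => /=; rewrite ?natrD /=; ring.
Qed.

(** The offset [k] carries the induction: it is the position of the walk after the letters already
    read. *)
Lemma mean_imbalance2 l ls (k : R) :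
  mean (halving_tree ls) (fun s => (k + imbalance l s) ^+ 2) = k ^+ 2 + (count_mem l ls)%:R.
Proof.
elim: ls k => [|l' ls IH] k /=; first by rewrite /imbalance /=; ring.
rewrite (eq_mean _ (fun s => congr1 (fun x => (k + x) ^+ 2) (imbalance_cons l l' true s))).
rewrite (eq_mean _ (fun s => congr1 (fun x => (k + x) ^+ 2) (imbalance_cons l l' false s))).
rewrite (eq_mean _ (fun s => congr1 (fun x => x ^+ 2) (addrA _ _ _))) IH.
rewrite (eq_mean _ (fun s => congr1 (fun x => x ^+ 2) (addrA _ _ _))) IH.
by rewrite natrD; case: (l' == l) => /=; field.
Qed.

Lemma mean_imbalance4 l ls (k : R) :
  mean (halving_tree ls) (fun s => (k + imbalance l s) ^+ 4) =
  k ^+ 4 + 6 * k ^+ 2 * (count_mem l ls)%:R + 3 * (count_mem l ls)%:R ^+ 2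
    - 2 * (count_mem l ls)%:R.
Proof.
elim: ls k => [|l' ls IH] k /=; first by rewrite /imbalance /=; ring.
rewrite (eq_mean _ (fun s => congr1 (fun x => (k + x) ^+ 4) (imbalance_cons l l' true s))).
rewrite (eq_mean _ (fun s => congr1 (fun x => (k + x) ^+ 4) (imbalance_cons l l' false s))).
rewrite (eq_mean _ (fun s => congr1 (fun x => x ^+ 4) (addrA _ _ _))) IH.
rewrite (eq_mean _ (fun s => congr1 (fun x => x ^+ 4) (addrA _ _ _))) IH.
by rewrite natrD; case: (l' == l) => /=; field.
Qed.

Lemma mean_count_halving l ls :
  mean (halving_tree ls)
    (fun s => (count_mem (l, true) s)%:R + (count_mem (l, false) s)%:R) =
  (count_mem l ls)%:R.
Proof.
elim: ls => [|l' ls IH] /=; first by ring.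
have step b s : ((((l', b) == (l, true)) + count_mem (l, true) s)%N%:R +
     (((l', b) == (l, false)) + count_mem (l, false) s)%N%:R : R) =
     (l' == l)%:R + ((count_mem (l, true) s)%:R + (count_mem (l, false) s)%:R).
  by rewrite !xpair_eqE !natrD; case: (l' == l); case: b => /=; ring.
rewrite (eq_mean _ (step true)) (eq_mean _ (step false)).
by rewrite meanD mean_cst IH natrD; field.
Qed.

Lemma fair_halving ls : fair_on (fun=> True) (halving_tree ls).
Proof. by elim: ls => //= l ls IH; split=> //; apply/andP; split; lra. Qed.

(* The fourth-moment lower bound for the first absolute moment of a random walk:
   [2 z^3 |x| - 3 z^2 x^2 + x^4 = |x| (|x| - z)^2 (|x| + 2 z)]. *)
Lemma norm_ge_moments (z x : R) : 0 < z ->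
  (3 * z ^+ 2 * x ^+ 2 - x ^+ 4) / (2 * z ^+ 3) <= `|x|.
Proof.
move=> z0; rewrite ler_pdivrMr ?mulr_gt0 ?exprn_gt0 // -[x ^+ 2]real_normK ?num_real //.
rewrite (_ : x ^+ 4 = `|x| ^+ 4); last first.
  by rewrite (exprM x 2 2) -[x ^+ 2]real_normK ?num_real // -exprM.
rewrite -subr_ge0.
have -> : `|x| * (2 * z ^+ 3) - (3 * z ^+ 2 * `|x| ^+ 2 - `|x| ^+ 4) =
  `|x| * (`|x| - z) ^+ 2 * (`|x| + 2 * z) by ring.
by rewrite mulr_ge0 //; [rewrite mulr_ge0 ?sqr_ge0|have := normr_ge0 x; lra].
Qed.

(** Each summand is the smaller of two counts, so this is the number of blocks met by the child
    whose [l]-th bit is, for every [l], the value requested less often. *)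
Definition halving_cost (s : seq L) : R :=
  \sum_(l < q) ((count_mem (l, true) s)%:R + (count_mem (l, false) s)%:R
                - `|imbalance l s|) / 2.

Lemma halving_cost_child s :
  exists i : I, (count (fun l => i \in half l) s)%:R = halving_cost s.
Proof.
exists [ffun l => (count_mem (l, true) s <= count_mem (l, false) s)%N].
set i := [ffun l => _].
have -> : count (fun l => i \in half l) s = (\sum_(l < q) count_mem (l, i l) s)%N.
  elim: s i => [|[l b] s IH] i /=; first by rewrite big1.
  rewrite IH big_split /=; congr addn.
  rewrite mem_half /= (bigD1 l) //= big1 ?addn0 ?xpair_eqE ?eqxx 1?eq_sym //.
  by move=> l' l'l; rewrite xpair_eqE eq_sym (negPf l'l).
rewrite natr_sum; apply: eq_bigr => l _; rewrite ffunE /imbalance.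
case: leqP => [le_tf|lt_ft].
  by rewrite ler0_norm ?subr_le0 ?ler_nat //; field.
by rewrite ger0_norm ?subr_ge0 ?ler_nat 1?ltnW //; field.
Qed.

Lemma mean_halving_cost (n : nat) (z : R) ls : 0 < z -> (forall l, count_mem l ls = n) ->
  mean (halving_tree ls) halving_cost <=
  q%:R * ((n%:R - (3 * z ^+ 2 * n%:R - (3 * n%:R ^+ 2 - 2 * n%:R)) / (2 * z ^+ 3)) / 2).
Proof.
move=> z0 cn; rewrite /halving_cost mean_sum.
set B := (X in _ <= _ * X).
have -> : q%:R * B = \sum_(l < q) B by rewrite sumr_const card_ord mulr_natl.
apply: ler_sum => l _; rewrite /B {B}.
have m2 := mean_imbalance2 l ls 0; have m4 := mean_imbalance4 l ls 0.
have mc := mean_count_halving l ls.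
rewrite cn in m2 m4 mc.
have z3 : 2 * z ^+ 3 != 0 by rewrite mulf_neq0 ?expf_neq0 ?gt_eqF.
apply: (le_trans (le_mean (G := fun s => 2^-1 * ((count_mem (l, true) s)%:R + (count_mem (l, false) s)%:R)
   + ((- (3 * z ^+ 2) / (4 * z ^+ 3)) * (0 + imbalance l s) ^+ 2 +
   (4 * z ^+ 3)^-1 * (0 + imbalance l s) ^+ 4)) (fair_halving ls) _)).
  move=> s; have := norm_ge_moments (imbalance l s) z0; rewrite !add0r.
  have -> : - (3 * z ^+ 2) / (4 * z ^+ 3) * imbalance l s ^+ 2 +
     (4 * z ^+ 3)^-1 * imbalance l s ^+ 4 =
     - ((3 * z ^+ 2 * imbalance l s ^+ 2 - imbalance l s ^+ 4) / (2 * z ^+ 3)) / 2.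
    by field; rewrite gt_eqF.
  lra.
rewrite !meanD !meanZ m2 m4 mc le_eqVlt; apply/orP; left; apply/eqP.
by field; rewrite gt_eqF.
Qed.

End Halving.

(** * Long run on one child, for two children with very different ratios *)

Section Run.
Fixpoint run_tree (H : nat) : adversary R bool :=
  if H is H'.+1 then Coin 2^-1 (Request true (run_tree H')) (Request false Stop) else Stop.

(** Each child is charged [A] on one side of the coin, and only one side continues: the gain obeys
    [g = (A + g') / 2] for both children. *)
Lemma run_gain (A G : R) H : 0 <= A -> A <= G ->
  gain (fun=> A) (fun b => [:: b]) G (run_tree H) (A * (1 - 2^-1 ^+ H)).
Proof.
move=> A0 AG; elim: H => [|H IH] /=; first by apply: GainStop; rewrite expr0; lra.
have h0 : 0 <= (2^-1 : R) ^+ H by rewrite exprn_ge0.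
have Ah0 : 0 <= A * 2^-1 ^+ H by rewrite mulr_ge0.
apply: (GainCoin (g1 := A * (1 - 2^-1 ^+ H)) (g2 := 0)) => //.
- by apply/andP; split; lra.
- exact: GainStop.
- lra.
- lra.
- by case; rewrite !inE /= exprS; lra.
Qed.

(** The offline hole stays in [true] unless the run reaches its full length; then [false] is never
    requested, and [M] pays for a trip there and back. *)
Definition run_cost (eps M : R) (s : seq bool) : R :=
  if false \in s then eps * (count_mem true s)%:R else M.

Lemma mean_run_cost (eps M : R) H :
  mean (run_tree H) (run_cost eps M) = eps + 2^-1 ^+ H * (M - eps * H.+1%:R).
Proof.
suff gen (j : R) : mean (run_tree H)
    (fun s => if false \in s then eps * (j + (count_mem true s)%:R) else M) =
    eps * (j + 1) + 2^-1 ^+ H * (M - eps * (j + H.+1%:R)).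
  have := gen 0; rewrite !add0r mulr1 => <-.
  by apply: eq_mean => s; rewrite add0r.
elim: H j => [|H IH] j /=; first by rewrite expr0; ring.
rewrite (eq_mean _ (G := fun s => if false \in s then
  eps * ((j + 1) + (count_mem true s)%:R) else M)); last first.
  by move=> s; rewrite inE /= natrD addrA.
by rewrite IH exprS -!natr1 /=; field.
Qed.

End Run.

(** * Biased gambler's ruin, for two children with comparable ratios *)

Section Gambler.
Context (N : nat) (p : R).

(** [y] is the fortune of a gambler who stops at 0 and at [N]; [s] limits the number of bets and
    keeps the tree finite. *)
Fixpoint gambler_tree (s y : nat) : adversary R bool :=
  if s is s'.+1 then
    if (0 < y < N)%N then
      Coin p (Request true (gambler_tree s' y.+1)) (Request false (gambler_tree s' y.-1))
    else Stop
  else Stop.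

Fixpoint duration (s y : nat) : R :=
  if s is s'.+1 then
    if (0 < y < N)%N then 1 + p * duration s' y.+1 + (1 - p) * duration s' y.-1 else 0
  else 0.

(** A walk that is still under way when the bets run out counts as lost. *)
Fixpoint win (s y : nat) : R :=
  if s is s'.+1 then
    if (0 < y < N)%N then p * win s' y.+1 + (1 - p) * win s' y.-1 else (y == N)%:R
  else (y == N)%:R.

Lemma mean_gambler_count s y :
  mean (gambler_tree s y) (fun u => (count_mem true u)%:R) = p * duration s y.
Proof.
elim: s y => [|s IH] y /=; first by rewrite mulr0.
case: ifP => _ /=; last by rewrite mulr0.
rewrite (eq_mean _ (G := fun u => 1 + (count_mem true u)%:R)); last first.
  by move=> u; rewrite /= natrD.
by rewrite meanD mean_cst !IH; ring.
Qed.

Lemma mean_gambler_win s y : (y <= N)%N ->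
  mean (gambler_tree s y)
    (fun u => ((y + count_mem true u)%N == (N + count_mem false u)%N)%:R) = win s y.
Proof.
elim: s y => [|s IH] y yN /=; first by rewrite !addn0.
case: ifP => [/andP[y0 ltyN]|_] /=; last by rewrite !addn0.
rewrite -!IH //; last by rewrite (leq_trans (leq_pred y)).
congr (_ * _ + _ * _); apply: eq_mean => u /=.
  by rewrite addnA addn1.
by congr (nat_of_bool _)%:R; case: y y0 {yN ltyN} => // y _ /=; lia.
Qed.

Context (p_gt0 : 0 < p) (p_le : p <= 2^-1).

Lemma duration_ge0 s y : 0 <= duration s y.
Proof.
have [p0 p1] := (p_gt0, p_le).
elim: s y => [|s IH] y //=; case: ifP => // _.
by rewrite !addr_ge0 ?mulr_ge0 ?IH //; lra.
Qed.

(** The quadratic drops by 1 in expectation under a fair step. It increases on [[0, N]], so the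
    downward drift [p <= 1/2] makes it drop even more; [y * (N - y)] would fail this in the upper
    half. *)
Lemma duration_le s y : (y <= N)%N -> duration s y <= y%:R * (2 * N%:R - y%:R).
Proof.
have [p0 p1] := (p_gt0, p_le).
have bnd0 (k : nat) : (k <= N)%N -> 0 <= k%:R * (2 * N%:R - k%:R) :> R.
  move=> kN; rewrite mulr_ge0 //.
  have : k%:R <= N%:R :> R by rewrite ler_nat.
  by have : 0 <= N%:R :> R by []; lra.
elim: s y => [|s IH] y yN /=; first exact: bnd0.
case: ifP => [/andP[y0 ltyN]|_]; last exact: bnd0.
have h1 := IH _ ltyN; have h2 := IH y.-1 (leq_trans (leq_pred y) yN).
have yE : y%:R = y.-1%:R + 1 :> R by rewrite natr1 prednK.
have yN' : y%:R <= N%:R :> R by rewrite ler_nat.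
have := ler_wpM2l (ltW p0) h1.
have := @ler_wpM2l _ (1 - p) _ _ _ h2; rewrite subr_ge0.
have -> : p <= 1 by lra.
move=> /(_ isT); rewrite -natr1.
have -> : y.-1%:R = y%:R - 1 :> R by rewrite yE; ring.
have : 0 <= (2^-1 - p) * (N%:R - y%:R) by rewrite mulr_ge0 ?subr_ge0.
lra.
Qed.

(** The bias balances the two children: either one is charged [alpha] per bet on average, so the
    gain is [alpha] times the expected number of bets, and [duration_le] bounds it by
    [alpha * N ^ 2]. *)
Lemma gambler_gain (A : bool -> R) (alpha G : R) s y : 0 <= alpha ->
  p * A true = alpha -> (1 - p) * A false = alpha -> (y <= N)%N ->
  alpha * N%:R ^+ 2 <= G ->
  gain A (fun b => [:: b]) G (gambler_tree s y) (alpha * duration s y).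
Proof.
have [p0 p1] := (p_gt0, p_le).
move=> a0 At Af + aG.
have dG s' y' : (y' <= N)%N -> alpha * duration s' y' <= G.
  move=> yN; apply: le_trans aG; rewrite ler_wpM2l //.
  apply: le_trans (duration_le _ yN) _.
  have := sqr_ge0 (N%:R - y'%:R : R); lra.
elim: s y => [|s IH] y yN /=; first by apply: GainStop; rewrite mulr0.
case: ifP => [/andP[y0 ltyN]|_]; last by apply: GainStop; rewrite mulr0.
have yN' : (y.-1 <= N)%N by apply: leq_trans (leq_pred y) yN.
apply: (GainCoin (g1 := alpha * duration s y.+1) (g2 := alpha * duration s y.-1)).
- by apply/andP; split; lra.
- exact: IH.
- exact: IH.
- exact: dG.
- exact: dG.
- by case; rewrite !inE /=; lra.
Qed.

Context (rho : R) (rhoE : p * rho = 1 - p).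

Let rho_gt0 : 0 < rho.
Proof.
have [p0 p1] := (p_gt0, p_le). by rewrite -(pmulr_rgt0 _ p0) rhoE; lra. Qed.

(** The closed form [(rho ^ y - 1) / (rho - 1)] is avoided in order to include [rho = 1]. The
    function is harmonic for the walk, so its quotient at [y] and [N] is the probability that the
    unlimited walk stops at [N]. *)
Definition partial_geometric (y : nat) : R := \sum_(i < y) rho ^+ i.

Lemma win_ge0 s y : 0 <= win s y.
Proof.
have [p0 p1] := (p_gt0, p_le).
elim: s y => [|s IH] y //=; case: ifP => // _.
by rewrite addr_ge0 ?mulr_ge0 //; lra.
Qed.

(** The defect of the truncated walk is at most the probability of being unfinished after [s] bets,
    hence at most the expected duration divided by [s]; the induction uses the quadratic of
    [duration_le]. *)
Lemma win_ge s y : (0 < N)%N -> (y <= N)%N ->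
  s%:R * (partial_geometric y / partial_geometric N - win s y)
    <= y%:R * (2 * N%:R - y%:R).
Proof.
have [p0 p1] := (p_gt0, p_le).
move=> N0; have gN : 0 < partial_geometric N.
  rewrite /partial_geometric; case: (N) N0 => // n _.
  by rewrite big_ord_recl expr0 ltr_wpDr // sumr_ge0 // => i _; rewrite exprn_ge0 // ltW.
have g_le y' : (y' <= N)%N -> partial_geometric y' / partial_geometric N <= 1.
  move=> yN; rewrite ler_pdivrMr // mul1r /partial_geometric.
  rewrite -!(big_mkord xpredT (fun i => rho ^+ i)) (big_cat_nat _ yN) //= lerDl.
  by rewrite sumr_ge0 // => i _; rewrite exprn_ge0 // ltW.
have bnd0 (k : nat) : (k <= N)%N -> 0 <= k%:R * (2 * N%:R - k%:R) :> R.
  move=> kN; rewrite mulr_ge0 //.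
  have : k%:R <= N%:R :> R by rewrite ler_nat.
  by have : 0 <= N%:R :> R by []; lra.
elim: s y => [|s IH] y yN; first by rewrite mul0r bnd0.
rewrite /=; case: ifP => [/andP[y0 ltyN]|yN']; last first.
  have [->|y0] := posnP y.
    by rewrite /partial_geometric big_ord0 mul0r eq_sym gtn_eqF // subrr !mulr0 mul0r.
  have -> : y = N by apply/eqP; rewrite eqn_leq yN; move: yN'; rewrite y0 /=; lia.
  by rewrite eqxx divff ?gt_eqF // subrr mulr0 bnd0.
have yN' := leq_trans (leq_pred y) yN.
have h1 := IH _ ltyN; have h2 := IH _ yN'.
have k1 : partial_geometric y.+1 / partial_geometric N - win s y.+1 <= 1.
  by have := g_le _ ltyN; have := win_ge0 s y.+1; lra.
have k2 : partial_geometric y.-1 / partial_geometric N - win s y.-1 <= 1.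
  by have := g_le _ yN'; have := win_ge0 s y.-1; lra.
have harm : partial_geometric y / partial_geometric N =
    p * (partial_geometric y.+1 / partial_geometric N) +
    (1 - p) * (partial_geometric y.-1 / partial_geometric N).
  rewrite !mulrA -mulrDl; congr (_ / _).
  case: y y0 {yN ltyN yN' h1 h2 k1 k2} => // y _ /=.
  rewrite /partial_geometric !big_ord_recr /= exprS.
  rewrite (_ : p * (_ + _ + _) = p * (\sum_(i < y) rho ^+ i + rho ^+ y) + (p * rho) * rho ^+ y); last by ring.
  by rewrite rhoE; ring.
set g1 := partial_geometric y.+1 / _ in h1 k1 harm.
set g2 := partial_geometric y.-1 / _ in h2 k2 harm.
rewrite harm -natr1.
have q0 : 0 <= 1 - p by lra.
have := ler_wpM2l (ltW p0) h1; have := ler_wpM2l q0 h2.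
have := ler_wpM2l (ltW p0) k1; have := ler_wpM2l q0 k2.
have yE : y%:R = y.-1%:R + 1 :> R by rewrite natr1 prednK.
have -> : y.-1%:R = y%:R - 1 :> R by rewrite yE; ring.
rewrite -natr1.
have : 0 <= (2^-1 - p) * (N%:R - y%:R) by rewrite mulr_ge0 ?subr_ge0 // ler_nat.
lra.
Qed.

End Gambler.

Lemma partial_geometric_double (rho : R) H : 0 < rho -> (0 < H)%N ->
  partial_geometric rho H / partial_geometric rho (H + H) = (1 + rho ^+ H)^-1.
Proof.
move=> rho0 H0; have gH : 0 < partial_geometric rho H.
  rewrite /partial_geometric; case: H H0 => // n _.
  by rewrite big_ord_recl expr0 ltr_wpDr // sumr_ge0 // => i _; rewrite exprn_ge0 // ltW.
have -> : partial_geometric rho (H + H) = partial_geometric rho H * (1 + rho ^+ H).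
  rewrite /partial_geometric big_split_ord /= mulrDr mulr1; congr (_ + _).
  by rewrite mulr_suml; apply: eq_bigr => i _; rewrite exprD mulrC.
by rewrite invfM mulrA divff ?mul1r // gt_eqF.
Qed.

End Games.

(** * Ratios obtained from the games *)

Section NodeRatios.
Context {R : realType} {T : finType} (d : T -> T -> R) (dM : is_metric d).
Context (delta : R) (delta_gt0 : 0 < delta).

Lemma le_forces Z a (A E E' : R) : E <= E' -> forces d Z a A E -> forces d Z a A E'.
Proof.
move=> EE' Fa Y w m ZY Y1 inZ outZ; apply: Fa => // x u xZ uY uZ.
by apply: le_trans (outZ _ _ xZ uY uZ); rewrite lerD2l.
Qed.

Lemma child_block Z h (r e eps : R) : 0 < eps -> e + r * eps <= delta ->
  ratio_on d Z h r e -> exists a, block d Z h a (r * eps) eps delta.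
Proof.
move=> eps0 ed [_ /(_ _ eps0)[a [hZ fa Da Fa]]]; exists a; split=> //.
exact: le_forces Fa.
Qed.

Lemma fair_point (x : T) :
  fair_on (fun y => y \in [set x]%SET) (Request x Stop : adversary R T).
Proof. by rewrite /= inE. Qed.

Section Halving.
Context {q : nat} (q0 : (0 < q)%N).
Local Notation I := {ffun 'I_q -> bool}.

Lemma halving_cst_neq : [ffun=> true] != [ffun=> false] :> I.
Proof. by apply/eqP => /ffunP/(_ (Ordinal q0)); rewrite !ffunE. Qed.

(** Each coordinate is drawn once, so the word complementary to the drawn bits is never requested:
    the offline hole pays only the trip of at most [32 * delta], against a forced
    [q * delta / 2]. *)
Lemma halving_points (h : I -> T) (i0 : I) (r : R) :
  (forall i j, i != j -> delta <= d (h i) (h j)) ->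
  (forall i j, d (h i) (h j) <= 16 * delta) ->
  0 < r -> r <= q%:R / 64 ->
  ratio_on d (node_union (fun i => [set h i]%SET)) (h i0) r (q%:R * (delta / 2) + delta).
Proof.
have delta0 := delta_gt0.
move=> h_ge h_le r0 rq.
have cn (l : 'I_q) : count_mem l (enum 'I_q) = 1%N.
  by rewrite count_uniq_mem ?enum_uniq // mem_enum.
have g : gain (fun=> delta) half (q%:R * (delta / 2)) (halving_tree (enum 'I_q)) (q%:R * (delta / 2)).
  by have := @halving_gain R q delta (q%:R * (delta / 2)) (enum 'I_q); rewrite size_enum_ord; apply => //; exact: ltW.
have q0' : 0 < q%:R :> R by rewrite ltr0n.
have cardV : (1 < #|node_union (fun i : I => [set h i]%SET)|)%N.
  apply: (node_union_card dM delta0 (h := h) _ _ halving_cst_neq).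
    by move=> i j x y ij; rewrite !inE => /eqP -> /eqP ->; exact: h_ge.
  by move=> i; rewrite inE.
pose c := fun s : seq ('I_q * bool) => 32 * delta + 32 * delta * halving_cost s.
have mc : mean (halving_tree (enum 'I_q)) c <= 32 * delta.
  rewrite /c meanD mean_cst meanZ gerDl mulr_ge0_le0 ?mulr_ge0 ?(ltW delta0) //.
  apply: le_trans (mean_halving_cost ltr01 cn) _.
  by rewrite !expr1n; apply: mulr_ge0_le0; [exact: ltW|lra].
apply: (block_ratio_on dM cardV (A := q%:R * (delta / 2)) (D := mean (halving_tree (enum 'I_q)) c)
  (a := expand (play_letter (fun i => Request (h i) Stop) half) (halving_tree (enum 'I_q)))) => //.
- by rewrite mulr_gt0 // divr_gt0.
- apply: le_trans (ler_wpM2l (ltW r0) mc) _.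
  have := ler_wpM2r (ltW delta0) rq; lra.
apply: (node_block dM (Z := fun i => [set h i]%SET) (A := fun=> delta)
    (eps := fun=> 32 * delta) (delta := delta)) => //.
- by move=> i j x y ij; rewrite !inE => /eqP -> /eqP ->; exact: h_ge.
- by move=> i; rewrite inE.
- by move=> i; exact: fair_point.
- by move=> i; exact: ltW.
- by move=> i; exact: forces_point.
- by move=> l; exact: enum_uniq.
- move=> i Y VY Y1; pose j : I := [ffun k => ~~ i k].
  have hY k : h k \in Y.
    by apply: (fintype.subsetP VY); apply/finset.bigcupP; exists k; rewrite ?inE.
  have ji : j != i.
    apply/eqP => /ffunP/(_ (Ordinal q0)); rewrite ffunE.
    by case: (i _).
  apply: (offline_point dM (h := h j)) => //.
    by apply: contraTneq (h_ge _ _ ji) => ->; rewrite (dist_xx dM) -ltNge.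
  have := h_le i j; rewrite mulr2n; lra.
- move=> s; have [i ci] := @halving_cost_child R q s; exists i.
  rewrite /c -ci mulr_natr lerD2r.
  have := h_le i0 i; rewrite mulr2n; lra.
Qed.

(** Each coordinate is drawn [s ^ 2] times, so its walk deviates by about [s], and the best child
    avoids about [q * s / 4] of the average [q * s ^ 2 / 2] blocks. By [512 * r <= q * s] the travel
    [32 * delta] uses up at most half of this saving. *)
Lemma halving_ratio (Z : I -> {set T}) (h : I -> T) (i0 : I) (s : nat) (r : R) (e : I -> R) :
  (forall i j x y, i != j -> x \in Z i -> y \in Z j -> delta <= d x y) ->
  (forall i j, d (h i) (h j) <= 16 * delta) ->
  (forall i, ratio_on d (Z i) (h i) r (e i)) -> (forall i, e i <= delta / 2) ->
  0 < r -> (0 < s)%N -> 512 * r <= q%:R * s%:R ->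
  ratio_on d (node_union Z) (h i0) (r + r / (4 * s%:R))
    (q%:R * s%:R ^+ 2 * (delta / 4) + delta).
Proof.
have delta0 := delta_gt0.
move=> sepZ h_le rZ e_le r0 s0 sq.
have q0' : 0 < q%:R :> R by rewrite ltr0n.
have s0' : 0 < s%:R :> R by rewrite ltr0n.
have eps0 : 0 < delta / (2 * r) by rewrite divr_gt0 ?mulr_gt0.
(* With this budget a block forces [delta / 2]; added to the exit cost [delta / 2] of the child this
   just fits the separation. *)
set eps := delta / (2 * r) in eps0.
have reps : r * eps = delta / 2 by rewrite /eps; field; rewrite gt_eqF.
have ch i : exists a, block d (Z i) (h i) a (r * eps) eps delta.
  by apply: child_block (rZ i) => //; rewrite reps; have := e_le i; lra.
have [f fP] := boolp.choice ch.
pose ls := flatten (nseq (s ^ 2) (enum 'I_q)).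
have cn (l : 'I_q) : count_mem l ls = (s ^ 2)%N.
  rewrite /ls; elim: (s ^ 2)%N => //= n IH.
  by rewrite count_cat IH count_uniq_mem ?enum_uniq // mem_enum add1n.
have szl : size ls = (s ^ 2 * q)%N.
  by rewrite size_flatten /shape map_nseq sumn_nseq size_enum_ord mulnC.
have szlE : (size ls)%:R * (delta / 2 / 2) = q%:R * s%:R ^+ 2 * (delta / 4).
  by rewrite szl natrM natrX; field.
have g : gain (fun=> delta / 2) half (q%:R * s%:R ^+ 2 * (delta / 4)) (halving_tree ls)
    (q%:R * s%:R ^+ 2 * (delta / 4)).
  rewrite -szlE; apply: halving_gain => //.
  by rewrite divr_ge0 // ltW.
have cardV : (1 < #|node_union Z|)%N.
  apply: (node_union_card dM delta0 (h := h) sepZ _ halving_cst_neq).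
  by move=> i; have [] := fP i.
pose c := fun s : seq ('I_q * bool) => 32 * delta + eps * halving_cost s.
(* The moment bound is best near [z = sqrt 3 * s]. The rational value [3 / 2 * s] still yields a
   mean deviation of at least [5 / 9 * s], and [s / 2] is enough. *)
have z0 : 0 < 3 / 2 * s%:R :> R by rewrite mulr_gt0.
have mc : mean (halving_tree ls) c <=
    eps * (q%:R * s%:R * (s%:R / 2 - 1 / 8)).
  rewrite /c meanD mean_cst meanZ.
  have := ler_wpM2l (ltW eps0) (mean_halving_cost z0 cn).
  have -> : (s ^ 2)%:R = s%:R ^+ 2 :> R by rewrite natrX.
  have -> : (3 * (3 / 2 * s%:R) ^+ 2 * s%:R ^+ 2 - (3 * s%:R ^+ 2 ^+ 2 - 2 * s%:R ^+ 2)) /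
     (2 * (3 / 2 * s%:R) ^+ 3) = 5 / 9 * s%:R + 8 / 27 / s%:R :> R.
    by field; rewrite gt_eqF.
  move=> mh; have -> : 32 * delta = eps * (64 * r) by rewrite -[delta](@divfK _ 2) // -reps; field.
  apply: le_trans (lerD (lexx _) mh) _; rewrite -mulrDr ler_pM2l //.
  have : q%:R * ((s%:R ^+ 2 - (5 / 9 * s%:R + 8 / 27 / s%:R)) / 2) <=
         q%:R * (s%:R ^+ 2 / 2 - s%:R / 4) :> R.
    rewrite ler_pM2l //.
    have : 0 < 8 / 27 / s%:R :> R by rewrite divr_gt0.
    lra.
  lra.
apply: (block_ratio_on dM cardV (A := q%:R * s%:R ^+ 2 * (delta / 4)) (D := mean (halving_tree ls) c)
  (a := expand (play_letter f half) (halving_tree ls))) => //.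
- by rewrite mulr_gt0 ?divr_gt0 ?mulr_gt0 ?exprn_gt0.
- by rewrite addr_gt0 ?divr_gt0 ?mulr_gt0.
- have r' : 0 <= r + r / (4 * s%:R) by rewrite addr_ge0 ?divr_ge0 ?mulr_ge0 // ltW.
  apply: le_trans (ler_wpM2l r' mc) _.
  have -> : delta / 4 = r * eps / 2 by rewrite reps; field.
  have -> : (r + r / (4 * s%:R)) * (eps * (q%:R * s%:R * (s%:R / 2 - 1 / 8))) =
    q%:R * s%:R ^+ 2 * (r * eps / 2) - r * eps * q%:R / 32.
    by field; rewrite gt_eqF.
  by rewrite gerBl divr_ge0 // mulr_ge0 // mulr_ge0 // ltW.
apply: (node_block dM (Z := Z) (A := fun=> delta / 2) (eps := fun=> eps) (delta := delta)) => //.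
- by move=> i; have [] := fP i.
- by move=> i; have [] := fP i.
- by move=> i; rewrite divr_ge0 // ltW.
- by move=> i; rewrite -reps; have [] := fP i.
- by move=> l; exact: enum_uniq.
- move=> i Y VY Y1; have [_ _ + _] := fP i; apply => //.
  by apply: fintype.subset_trans VY; apply/fintype.subsetP => y; exact: in_node_union.
- move=> u; have [i ci] := @halving_cost_child R q u; exists i.
  rewrite /c -ci mulr_natr lerD2r.
  have := h_le i0 i; rewrite mulr2n; lra.
Qed.

End Halving.

Section Pair.
Context (Z1 Z2 : {set T}) (h1 h2 : T).
Context (sep12 : forall x y, x \in Z1 -> y \in Z2 -> delta <= d x y).
Context (h12_le : d h1 h2 <= 16 * delta).

Let pair_set (Z Z' : {set T}) (b : bool) : {set T} := if b then Z else Z'.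

Let sep_pair (Z : {set T}) (i j : bool) x y : {subset Z <= Z2} -> i != j ->
  x \in pair_set Z1 Z i -> y \in pair_set Z1 Z j -> delta <= d x y.
Proof.
move=> ZZ2; case: i; case: j => //= _ xi yj; first exact/sep12/ZZ2.
by rewrite (dist_sym dM); apply: sep12 => //; exact: ZZ2.
Qed.

Lemma run_ratio (r e : R) H : ratio_on d Z1 h1 r e -> h2 \in Z2 -> 0 < r -> e <= delta / 2 ->
  64 * r + 1 <= H%:R ->
  exists2 Z : {set T}, Z \subset (Z1 :|: Z2)%SET &
    ratio_on d Z h1 (r * (1 + 2^-1 ^+ H)) (2 * delta).
Proof.
have h12 := h12_le.
have delta0 := delta_gt0.
move=> rZ h2Z r0 ed Hr.
have eps0 : 0 < delta / (2 * r) by rewrite divr_gt0 ?mulr_gt0.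
set eps := delta / (2 * r) in eps0.
have reps : r * eps = delta / 2 by rewrite /eps; field; rewrite gt_eqF.
have [f fP] : exists a, block d Z1 h1 a (r * eps) eps delta.
  by apply: child_block rZ => //; rewrite reps; lra.
have subZ2 : {subset [set h2]%SET <= Z2} by move=> x; rewrite inE => /eqP ->.
exists (node_union (pair_set Z1 [set h2]%SET)).
  apply/fintype.subsetP => x /finset.bigcupP[[] _ /= xZ]; rewrite inE; first by rewrite xZ.
  by rewrite (subZ2 _ xZ) orbT.
have cardV : (1 < #|node_union (pair_set Z1 [set h2]%SET)|)%N.
  apply: (node_union_card dM delta0 (h := fun b : bool => if b then h1 else h2) _ _ (isT : true != false)).
    by move=> i j x y; exact: sep_pair.
  by case; rewrite /= ?inE //; have [] := fP.
pose fs b : adversary R T := if b then f else Request h2 Stop.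
have g : gain (fun=> delta / 2) (fun b => [:: b]) delta (run_tree H) (delta / 2 * (1 - 2^-1 ^+ H)).
  by apply: run_gain; lra.
have h0 : 0 < (2^-1 : R) ^+ H by rewrite exprn_gt0.
have h1' : (2^-1 : R) ^+ H < 1.
  rewrite exprn_ilt1; [|by lra|by lra].
  apply/eqP => H0; rewrite H0 in Hr; lra.
set pw := _ ^+ H in g h0 h1' *.
have H2 : 32 * delta - eps * H.+1%:R <= - (2 * eps).
  have -> : 32 * delta = eps * (64 * r) by rewrite -[delta](@divfK _ 2) // -reps; field.
  have := ler_wpM2l (ltW eps0) Hr; rewrite -natr1; lra.
have -> : 2 * delta = delta + delta by ring.
apply: (block_ratio_on dM cardV (A := delta / 2 * (1 - pw))
  (D := mean (run_tree H) (run_cost eps (32 * delta)))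
  (a := expand (play_letter fs (fun b => [:: b])) (run_tree H))) => //.
- by rewrite mulr_gt0 ?subr_gt0 ?divr_gt0.
- by rewrite mulr_gt0 // addr_gt0.
- rewrite mean_run_cost -/pw -reps.
  have h2' : eps + pw * (32 * delta - eps * H.+1%:R) <= eps * (1 - 2 * pw).
    by have := ler_wpM2l (ltW h0) H2; lra.
  have r' : 0 <= r * (1 + pw) by rewrite mulr_ge0 ?addr_ge0 // ltW.
  apply: le_trans (ler_wpM2l r' h2') _.
  have -> : r * (1 + pw) * (eps * (1 - 2 * pw)) = r * eps * (1 - pw) - r * eps * pw ^+ 2 *+ 2 by ring.
  by rewrite gerBl mulrn_wge0 // reps mulr_ge0 ?divr_ge0 ?sqr_ge0 // ltW.
have g2 : gain (fun=> delta / 2) (fun b => [:: b]) delta (run_tree H) (delta / 2 * (1 - pw)) by [].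
pose hs (b : bool) := if b then h1 else h2; rewrite -[h1]/(hs true).
apply: (node_block dM (Z := pair_set Z1 [set h2]%SET) (h := hs)
   (A := fun=> delta / 2) (eps := fun b => if b then eps else 32 * delta) (delta := delta)) => //.
- by move=> i j x y; exact: sep_pair.
- by case; rewrite /= ?inE //; have [] := fP.
- by case; [have [] := fP|exact: fair_point].
- by move=> i; rewrite divr_ge0 // ltW.
- case => /=; first by rewrite -reps; have [] := fP.
  by apply: (@le_forces _ _ _ (delta / 2)); [lra|exact: forces_point].
- have h1Z : h1 \in Z1 by have [] := fP.
  case=> Y VY Y1 /=.
    have [_ _ + _] := fP; apply => //.
    apply: fintype.subset_trans VY; apply/fintype.subsetP => y yZ.
    by apply/finset.bigcupP; exists true.
  apply: (offline_point dM (h := h1)).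
  + by apply: contraTneq (sep12 h1Z h2Z) => ->; rewrite (dist_xx dM) -ltNge.
  + by rewrite (dist_sym dM) mulr2n; lra.
  + by apply/(fintype.subsetP VY)/finset.bigcupP; exists true.
  + by apply/(fintype.subsetP VY)/finset.bigcupP; exists false; rewrite //= inE.
- move=> s; rewrite /run_cost; case: ifPn => fs'.
    exists true; rewrite (dist_xx dM) mul0rn add0r mulr_natr.
    by rewrite (eq_count (a2 := pred1 true)) // => l; rewrite inE eq_sym.
  exists false; rewrite (eq_count (a2 := pred1 false)); last first.
    by move=> l; rewrite inE eq_sym.
  rewrite (count_memPn fs') mulr0n addr0 mulr2n; lra.
Qed.

(** The offline hole stays in [Z1], unless the walk stops at [N]: then it spends the game in [Z2],
    where [H] fewer blocks are played. Half of the saving [eps * H] pays for the travel, by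
    [128 * r1 <= H]. *)
Lemma gambler_ratio (r1 r2 e1 e2 : R) H :
  ratio_on d Z1 h1 r1 e1 -> ratio_on d Z2 h2 r2 e2 ->
  0 < r2 -> r2 <= r1 -> e1 <= delta / 2 -> e2 <= delta / 2 ->
  128 * r1 <= H%:R ->
  exists2 Z : {set T}, Z \subset (Z1 :|: Z2)%SET &
    ratio_on d Z h1 (r1 + r1 / (6 * H%:R * (1 + (r1 / r2) ^+ H)))
      (delta * H%:R ^+ 2 + delta).
Proof.
have h12 := h12_le.
have delta0 := delta_gt0.
move=> rZ1 rZ2 r20 r21 ed1 ed2 Hr.
have r10 : 0 < r1 by apply: lt_le_trans r21.
have H0' : 0 < H%:R :> R by apply: lt_le_trans Hr; rewrite mulr_gt0.
have H0 : (0 < H)%N by rewrite ltr0n in H0'.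
have eps0 : 0 < delta / (2 * r1) by rewrite divr_gt0 ?mulr_gt0.
set eps := delta / (2 * r1) in eps0.
have reps : r1 * eps = delta / 2 by rewrite /eps; field; rewrite gt_eqF.
have r2eps : r2 * eps <= delta / 2 by rewrite -reps ler_pM2r.
have [f1 fP1] : exists a, block d Z1 h1 a (r1 * eps) eps delta.
  by apply: child_block rZ1 => //; rewrite reps; lra.
have [f2 fP2] : exists a, block d Z2 h2 a (r2 * eps) eps delta.
  by apply: child_block rZ2 => //; lra.
exists (node_union (pair_set Z1 Z2)).
  apply/fintype.subsetP => x /finset.bigcupP[[] _] /=; rewrite inE => ->//.
  by rewrite orbT.
have cardV : (1 < #|node_union (pair_set Z1 Z2)|)%N.
  apply: (node_union_card dM delta0 (h := fun b : bool => if b then h1 else h2) _ _ (isT : true != false)).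
    by move=> i j x y; exact: sep_pair.
  by case; [have [] := fP1|have [] := fP2].
pose fs b : adversary R T := if b then f1 else f2.
(* This bias equalises [p * r1] and [(1 - p) * r2], the expected charges of one bet in the two
   children. *)
pose p := r2 / (r1 + r2); pose rho := r1 / r2.
have r12 : 0 < r1 + r2 by rewrite addr_gt0.
have p0 : 0 < p by rewrite divr_gt0.
have p1 : p <= 2^-1 by rewrite /p ler_pdivrMr //; lra.
have rho0 : 0 < rho by rewrite divr_gt0.
have rhoE : p * rho = 1 - p by rewrite /p /rho; field; rewrite !gt_eqF.
pose A b : R := (if b then r1 else r2) * eps.
pose alpha := p * (r1 * eps).
have alpha0 : 0 < alpha by rewrite /alpha reps mulr_gt0 // divr_gt0.
have alphaE : (1 - p) * (r2 * eps) = alpha by rewrite /alpha /p; field; rewrite gt_eqF.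
have alpha_le : alpha <= delta / 4.
  rewrite /alpha reps; have := ler_wpM2r (ltW delta0) p1; lra.
pose N := (H + H)%N.
have HN : (H <= N)%N by rewrite leq_addr.
have NE : N%:R = 2 * H%:R :> R by rewrite natrD; ring.
pose w := (1 + rho ^+ H)^-1.
have w0 : 0 < w by rewrite invr_gt0 addr_gt0 // exprn_gt0.
(* Enough bets for the truncation to lose at most [3 * H ^ 2 / t <= w / 2] of the winning
   probability [w]. *)
pose t := (Num.truncn (6 * H%:R ^+ 2 / w)).+1.
have tw : 6 * H%:R ^+ 2 <= t%:R * w.
  rewrite -ler_pdivrMr // ltW //.
  have /truncn_itv/andP[_ //] : 0 <= 6 * H%:R ^+ 2 / w.
  by rewrite divr_ge0 ?mulr_ge0 ?exprn_ge0 // ltW.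
set dur := duration N p t H; set W := win N p t H.
have dur_le : dur <= 3 * H%:R ^+ 2.
  by apply: le_trans (duration_le p0 p1 _ HN) _; rewrite NE; lra.
have dur_ge : 1 <= dur.
  rewrite /dur /t /=; have -> : (0 < H < N)%N by rewrite H0 /N -[ltnLHS]addn0 ltn_add2l.
  have p1' : 0 <= 1 - p by lra.
  rewrite -addrA lerDl addr_ge0 // mulr_ge0 ?duration_ge0 //; exact: ltW.
have W_ge : w / 2 <= W.
  have N0 : (0 < N)%N by rewrite addn_gt0 H0.
  have := win_ge p0 p1 rhoE t N0 HN.
  rewrite (partial_geometric_double rho0 H0) -/w -/W NE => hW.
  have t0 : 0 < t%:R :> R by rewrite ltr0n.
  have : t%:R * (w - W) <= t%:R * (w / 2) by lra.
  rewrite ler_pM2l //; lra.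
have W0 : 0 <= W by apply: le_trans W_ge; rewrite divr_ge0 // ltW.
pose c (u : seq bool) : R := eps * (count_mem true u)%:R + (- (eps * (H%:R / 2))) *
   ((H + count_mem true u)%N == (N + count_mem false u)%N)%:R.
have mc : mean (gambler_tree N p t H) c = eps * (p * dur - H%:R / 2 * W).
  rewrite /c meanD !meanZ mean_gambler_count mean_gambler_win //.
  by rewrite -/dur -/W; ring.
have g : gain A (fun b => [:: b]) (delta * H%:R ^+ 2) (gambler_tree N p t H) (alpha * dur).
  apply: gambler_gain => //; first exact: ltW.
  have := ler_wpM2r (sqr_ge0 N%:R) alpha_le; rewrite NE; lra.
have frac0 : 0 <= r1 / (6 * H%:R * (1 + rho ^+ H)).
  by rewrite divr_ge0 ?mulr_ge0 ?addr_ge0 ?exprn_ge0 // ltW.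
have rnew : r1 + r1 / (6 * H%:R * (1 + rho ^+ H)) <= r1 * (1 + W / (3 * H%:R)).
  have -> : r1 / (6 * H%:R * (1 + rho ^+ H)) = r1 * ((w / 2) / (3 * H%:R)).
    by rewrite /w; field; rewrite !gt_eqF ?addr_gt0 ?exprn_gt0.
  by rewrite mulrDr mulr1 lerD2l ler_pM2l // ler_pM2r // invr_gt0 mulr_gt0.
apply: (block_ratio_on dM cardV (A := alpha * dur) (D := mean (gambler_tree N p t H) c)
  (a := expand (play_letter fs (fun b => [:: b])) (gambler_tree N p t H))) => //.
- by rewrite mulr_gt0 //; apply: lt_le_trans dur_ge.
- by rewrite ltr_wpDr.
- rewrite mc; have [neg|pos] := leP (p * dur - H%:R / 2 * W) 0.
    apply: le_trans (_ : 0 <= _); last by rewrite mulr_ge0 ?(ltW alpha0) // (le_trans _ dur_ge).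
    by rewrite mulr_ge0_le0 ?addr_ge0 ?(ltW r10) // mulr_ge0_le0 // ltW.
  apply: le_trans (ler_wpM2r (mulr_ge0 (ltW eps0) (ltW pos)) rnew) _.
  rewrite /alpha.
  have -> : r1 * (1 + W / (3 * H%:R)) * (eps * (p * dur - H%:R / 2 * W)) =
    p * (r1 * eps) * dur - r1 * eps * W * (H%:R / 2 + W / 6 - p * dur / (3 * H%:R)).
    by field; rewrite gt_eqF.
  rewrite gerBl; apply: mulr_ge0; first by rewrite reps mulr_ge0 // divr_ge0 // ltW.
  have pd : p * dur <= 2^-1 * (3 * H%:R ^+ 2).
    by apply: ler_pM => //; [exact: ltW|exact: le_trans dur_ge].
  have : p * dur / (3 * H%:R) <= H%:R / 2.
    rewrite ler_pdivrMr ?mulr_gt0 //; lra.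
  lra.
pose hs (b : bool) := if b then h1 else h2; rewrite -[h1]/(hs true).
apply: (node_block dM (Z := pair_set Z1 Z2) (h := hs)
   (A := A) (eps := fun=> eps) (delta := delta)) => //.
- by move=> i j x y; exact: sep_pair.
- by case; [have [] := fP1|have [] := fP2].
- by case; [have [] := fP1|have [] := fP2].
- by case; rewrite /A mulr_ge0 // ltW.
- by case; [have [] := fP1|have [] := fP2].
- case=> Y VY Y1 /=.
    have [_ _ + _] := fP1; apply => //.
    apply: fintype.subset_trans VY; apply/fintype.subsetP => y yZ.
    by apply/finset.bigcupP; exists true.
  have [_ _ + _] := fP2; apply => //.
  apply: fintype.subset_trans VY; apply/fintype.subsetP => y yZ.
  by apply/finset.bigcupP; exists false.
- have eqc b (u : seq bool) : count (fun l => b \in [:: l]) u = count_mem b u.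
    by apply: eq_count => l; rewrite inE eq_sym.
  move=> u; rewrite /c; case: eqP => [eqN|_].
    exists false; rewrite eqc mulr1.
    have eqN' : H%:R + (count_mem true u)%:R = 2 * H%:R + (count_mem false u)%:R :> R.
      by rewrite -NE -!natrD eqN.
    have -> : (count_mem true u)%:R = H%:R + (count_mem false u)%:R :> R by lra.
    rewrite mulr2n -mulr_natr.
    have : 32 * delta <= eps * (H%:R / 2).
      have -> : 32 * delta = eps * (64 * r1) by rewrite -[delta](@divfK _ 2) // -reps; field.
      by rewrite ler_pM2l //; lra.
    lra.
  exists true; rewrite (dist_xx dM) mul0rn add0r eqc mulr0 addr0.
  by rewrite mulr_natr.
Qed.

End Pair.
End NodeRatios.

(** * Combining the hard children of a node *)

Section Dyadic.
Context {R : realType}.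

Lemma ln_le_subr1 (x : R) : 0 < x -> ln x <= x - 1.
Proof.
move=> x0; have := @le_ln1Dx R (x - 1).
by rewrite addrCA subrr addr0; apply; lra.
Qed.

Lemma ln2_le1 : ln 2 <= 1 :> R.
Proof. by have := @ln_le_subr1 2; rewrite (_ : 2 - 1 = 1 :> R); [exact|ring]. Qed.

Lemma ln2_ge_half : 2^-1 <= ln 2 :> R.
Proof.
have h : 0 < 2^-1 :> R by [].
have := ln_le_subr1 h; rewrite lnV ?posrE //; lra.
Qed.

(** The indices from [2 ^ q - 1] to [2 ^ (q + 1) - 2] are [2 ^ q] in number with terms at most
    [C / 4 ^ q], so they contribute at most [C / 2 ^ q]. *)
Lemma dyadic_sum_le (f : nat -> R) (C : R) m :
  (forall i j, (i <= j)%N -> f j <= f i) ->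
  (forall q, (0 < q)%N -> f (2 ^ q).-1 <= C / 4 ^+ q) ->
  \sum_(0 <= i < (2 ^ m.+1).-1) f i <= f 0%N + C * (1 - 2^-1 ^+ m).
Proof.
move=> mono fC; elim: m => [|m IH].
  by rewrite big_nat1 expr0 subrr mulr0 addr0.
have e1 : (0 < 2 ^ m.+1)%N by rewrite expn_gt0.
have e2 : (2 ^ m.+2 = 2 ^ m.+1 + 2 ^ m.+1)%N by rewrite (expnS 2 m.+1) mul2n addnn.
have e3 : ((2 ^ m.+1).-1 <= (2 ^ m.+2).-1)%N by rewrite e2; lia.
rewrite (big_cat_nat _ e3) //=.
have : \sum_((2 ^ m.+1).-1 <= i < (2 ^ m.+2).-1) f i <= C / 2 ^+ m.+1.
  apply: (@le_trans _ _ (\sum_((2 ^ m.+1).-1 <= i < (2 ^ m.+2).-1) C / 4 ^+ m.+1)).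
    rewrite big_seq [leRHS]big_seq; apply: ler_sum => i.
    rewrite mem_index_iota => /andP[mi _].
    exact: le_trans (mono _ _ mi) (fC m.+1 isT).
  rewrite sumr_const_nat (_ : (_ - _)%N = (2 ^ m.+1)%N); last by rewrite e2; lia.
  rewrite -[leLHS]mulr_natr natrX (_ : 4 = 2 * 2 :> R); last by ring.
  by rewrite exprMn invfM mulrA -[X in _ <= X]mulr1 -mulrA mulVf // expf_neq0.
move=> h; apply: le_trans (lerD IH h) _.
rewrite -exprVn exprS; lra.
Qed.

Lemma nth_geq_mono (m : seq nat) i j : sorted geq m -> (i <= j)%N ->
  (nth 0%N m j <= nth 0%N m i)%N.
Proof.
move=> sm ij; have [js|js] := ltnP j (size m); last by rewrite (nth_default 0%N js).
have gt : transitive geq by move=> a b c /= h1 h2; exact: leq_trans h2 h1.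
have gr : reflexive geq by move=> a /=.
have H := @sorted_leq_nth nat geq gt gr 0%N m sm i j.
by apply: H; rewrite ?inE //; exact: leq_ltn_trans ij js.
Qed.

(* With [S := sumn m]: if the first alternative fails then [m_(2^q - 1)] is at most
   [m_1] and at most [S / 16^q], hence at most [sqrt (m_1 S) / 4^q], and the dyadic
   blocks of [m] after the first item add up to at most [sqrt (m_1 S)]. *)
Lemma dyadic_dichotomy (m : seq nat) : sorted geq m ->
  (exists q, (0 < q)%N /\ (sumn m < 16 ^ q * nth 0%N m (2 ^ q).-1)%N) \/
  (16 * nth 0%N m 1 <= sumn m)%N /\
  (sumn m)%:R - (nth 0%N m 0)%:R <= Num.sqrt ((nth 0%N m 1)%:R * (sumn m)%:R) :> R.
Proof.
move=> sm; have [qP|nq] := pselect (exists q, (0 < q)%N /\ (sumn m < 16 ^ q * nth 0%N m (2 ^ q).-1)%N).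
  by left.
right; have le_q q : (0 < q)%N -> (16 ^ q * nth 0%N m (2 ^ q).-1 <= sumn m)%N.
  by move=> q0; rewrite leqNgt; apply/negP => qlt; apply: nq; exists q.
split; first by have := le_q 1%N isT; rewrite !expn1.
pose f i : R := (nth 0%N m i)%:R.
pose C : R := Num.sqrt ((nth 0%N m 1)%:R * (sumn m)%:R).
have C0 : 0 <= C by exact: sqrtr_ge0.
have mono i j : (i <= j)%N -> f j <= f i by move=> ij; rewrite ler_nat nth_geq_mono.
have fC q : (0 < q)%N -> f (2 ^ q).-1 <= C / 4 ^+ q.
  move=> q0; rewrite ler_pdivlMr ?exprn_gt0 //.
  rewrite -[leLHS]ger0_norm ?mulr_ge0 ?exprn_ge0 // -sqrtr_sqr ler_sqrt ?mulr_ge0 //.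
  have h1 : f (2 ^ q).-1 <= f 1%N.
    by apply: mono; have : (2 ^ 1 <= 2 ^ q)%N; [rewrite leq_exp2l|rewrite expn1 => h2q; rewrite -ltnS prednK ?expn_gt0].
  have h2 : f (2 ^ q).-1 * 16 ^+ q <= (sumn m)%:R.
    by rewrite -natrX -natrM ler_nat mulnC le_q.
  rewrite exprMn -exprM mulnC exprM (_ : 4 ^+ 2 = 16); last by ring.
  by rewrite expr2 -mulrA; apply: ler_pM => //; rewrite mulr_ge0 ?exprn_ge0.
have := dyadic_sum_le (size m) mono fC.
have sz : (size m <= (2 ^ (size m).+1).-1)%N.
  by rewrite -ltnS prednK ?expn_gt0 // (leq_trans (ltn_expl (size m) (isT : (1 < 2)%N))) // leq_exp2l.
have sE : (sumn m)%:R = \sum_(0 <= i < size m) f i.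
  by rewrite sumnE (big_nth 0%N) natr_sum.
rewrite (big_cat_nat _ sz) //= -sE => h.
have : 0 <= \sum_(size m <= i < (2 ^ (size m).+1).-1) f i by apply: sumr_ge0.
have : 0 <= C * 2^-1 ^+ size m by rewrite mulr_ge0 ?exprn_ge0.
move: h; rewrite -/(f 0%N) -/C; lra.
Qed.

Lemma truncnS_le (x : R) : 0 <= x -> (Num.truncn x).+1%:R <= x + 1.
Proof. by move=> /truncn_itv/andP[tx _]; rewrite -natr1 lerD2r. Qed.

(** In the application [L] is the target and [t = sqrt (n1 / N)]. As [r2 < r1 / 2], the bound on
    [r1 - r2] makes [r1], and with it [H], small compared with [ln (t^-1)]; so [2^-1 ^+ H] is at
    least [t / 4] and makes up for the missing [4 / 3 * c * t]. *)
Lemma run_margin (L c r1 r2 t : R) (H : nat) : L <= r1 + 4 / 3 * c * t ->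
  1 / 128 <= r1 -> 512 * c <= 1 / 20 -> 0 < t -> r2 < r1 / 2 ->
  1024 * (r1 - r2) <= 2 * ln (t^-1) -> H%:R <= 64 * r1 + 2 ->
  L <= r1 * (1 + 2^-1 ^+ H).
Proof.
move=> r1L r1_ge c512 t0 r21 diff H2; have tV0 : 0 < t^-1 by rewrite invr_gt0.
have pw : t / 4 <= 2^-1 ^+ H.
  have -> : t / 4 = (4 / t)^-1 by field; rewrite gt_eqF.
  rewrite exprVn lef_pV2 ?posrE ?exprn_gt0 ?divr_gt0 //.
  rewrite -ler_ln ?posrE ?exprn_gt0 ?divr_gt0 // lnXn // lnM ?posrE //.
  rewrite (_ : 4 = 2 * 2 :> R); last by ring.
  rewrite lnM ?posrE // -[ln 2 *+ _]mulr_natr.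
  have l2 : 0 <= ln 2 :> R by rewrite ln_ge0 // ler1n.
  have := ler_wpM2l l2 H2.
  have : ln 2 * r1 <= 1 * r1 by rewrite ler_wpM2r ?ln2_le1 //; lra.
  lra.
have r10 : 0 < r1 by lra.
have := ler_wpM2l (ltW r10) pw; have := ler_wpM2r (ltW t0) r1_ge.
have := ler_wpM2r (ltW t0) c512; lra.
Qed.

(** Here [H * ln (r1 / r2)] is at most [512 * (r1 - r2)], hence at most [ln (t^-1)]: raised to the
    power [H], the quotient of the ratios stays below [t^-1]. The increment is then at least
    [t / 3072], more than the missing [4 / 3 * c * t]. *)
Lemma gambler_margin (L c r1 r2 t : R) (H : nat) : L <= r1 + 4 / 3 * c * t ->
  128 * 96 * c = 1 -> 0 < r2 -> r2 <= r1 -> r1 / 2 <= r2 -> 0 < t -> t <= 1 / 4 ->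
  1024 * (r1 - r2) <= 2 * ln (t^-1) -> (0 < H)%N -> H%:R <= 256 * r1 ->
  L <= r1 + r1 / (6 * H%:R * (1 + (r1 / r2) ^+ H)).
Proof.
move=> r1L cE r20 r21 r12 t0 t4 diff H0' H2.
have lnt : 512 * (r1 - r2) <= ln (t^-1) by lra.
have H0 : 0 < H%:R :> R by rewrite ltr0n.
have r10 : 0 < r1 by apply: lt_le_trans r21.
have tV0 : 0 < t^-1 by rewrite invr_gt0.
have rho0 : 0 < r1 / r2 by rewrite divr_gt0.
have rho : (r1 / r2) ^+ H <= t^-1.
  rewrite -ler_ln ?posrE ?exprn_gt0 // lnXn // -mulr_natl.
  have l1 : ln (r1 / r2) <= (r1 - r2) * (2 / r1).
    apply: le_trans (ln_le_subr1 rho0) _.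
    have -> : r1 / r2 - 1 = (r1 - r2) / r2 by field; rewrite gt_eqF.
    rewrite ler_wpM2l ?subr_ge0 // ler_pdivlMr // mulrC ler_pdivrMr //; lra.
  apply: le_trans (ler_wpM2l (ltW H0) l1) _; apply: le_trans lnt.
  have -> : 512 * (r1 - r2) = 256 * r1 * ((r1 - r2) * (2 / r1)) by field; rewrite gt_eqF.
  apply: ler_wpM2r H2; apply: mulr_ge0; first by rewrite subr_ge0.
  by rewrite divr_ge0 // ltW.
have pp : 0 < 1 + (r1 / r2) ^+ H by rewrite addr_gt0 // exprn_gt0.
have tp : t * (1 + (r1 / r2) ^+ H) <= 2.
  have tt : t * t^-1 = 1 by rewrite divff // gt_eqF.
  have := ler_wpM2l (ltW t0) rho; rewrite tt mulrDr mulr1 => tr; lra.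
have margin : t / (3 * 1024) <= r1 / (6 * H%:R * (1 + (r1 / r2) ^+ H)).
  rewrite ler_pdivlMr; last by rewrite !mulr_gt0.
  have tp0 : 0 <= t * (1 + (r1 / r2) ^+ H) by apply: mulr_ge0; exact: ltW.
  have := ler_pM tp0 (ltW H0) tp H2; lra.
have : 128 * 96 * c * t = t by rewrite cE mul1r.
move: r1L margin; lra.
Qed.

End Dyadic.

Section NodeHard.
Context {R : realType} {T : finType} (d : T -> T -> R) (dM : is_metric d).

(** Dictated by the halving game: a loss of [16 ^ q] in size lowers the target by at most
    [4 * rate * q], and halving with [q * k <= 768 * r] gains [r / (4 * k) >= q / 3072]. The two
    agree for this value. *)
Definition rate : R := (128 * 96)^-1.

(* [n = 1] is the size claimed for a single point, where no ratio is available. *)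
Definition hard (Z : {set T}) (n : nat) (e : R) : Prop :=
  exists h (Z' : {set T}), [/\ Z' \subset Z, h \in Z', (0 < n)%N &
    (1 < n)%N -> ratio_on d Z' h (rate * ln n%:R) e].

Lemma ratio_on_le_r (Z : {set T}) h (r r' e : R) : 0 < r' -> r' <= r ->
  ratio_on d Z h r e -> ratio_on d Z h r' e.
Proof.
move=> r'0 rr' [Z1 rZ]; split=> // eps eps0; have r0 : 0 < r by apply: lt_le_trans rr'.
have e'0 : 0 < eps * r' / r by rewrite divr_gt0 ?mulr_gt0.
have e'le : eps * r' / r <= eps by rewrite ler_pdivrMr // ler_pM2l.
have re : r * (eps * r' / r) = r' * eps by field; rewrite gt_eqF.
have [a [hZ fa Da Fa]] := rZ _ e'0; exists a; rewrite -re; split=> // Y ZY Y1.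
exact: le_trans (Da Y ZY Y1) e'le.
Qed.

(** An upper bound, in units of the separation, for the exit costs of all three games: with
    [H <= 256 * r] and [q * k <= 768 * r] they are at most [(256 * r) ^ 2 + 1] and
    [(384 * r) ^ 2 + 1]. *)
Definition overhead (N : nat) : R := (400 * (1 + ln N%:R)) ^+ 2.

Lemma overhead_ge (N : nat) (r : R) : (0 < N)%N -> 0 <= r -> r <= ln N%:R ->
  400 ^+ 2 * (r ^+ 2 + 1) <= overhead N.
Proof.
move=> N0 r0 rN; rewrite /overhead exprMn.
have := mulr_ge0 r0 r0; have : r * r <= ln N%:R * ln N%:R :> R by apply: ler_pM.
move=> rr r20; apply: ler_wpM2l; [exact: sqr_ge0|rewrite !expr2; lra].
Qed.

Section Children.
Context {J : eqType} (s : seq J) (n : J -> nat) (h : J -> T) (Z : J -> {set T}) (X : {set T}).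
Context (delta : R) (delta_gt0 : 0 < delta).
Context (us : uniq s) (sorted_s : sorted geq (map n s)).
Context (ZX : forall j, j \in s -> Z j \subset X).
Context (hZ : forall j, j \in s -> h j \in Z j).
Context (sepZ : forall i j x y, i \in s -> j \in s -> i != j ->
  x \in Z i -> y \in Z j -> delta <= d x y).
Context (diamZ : forall i j, i \in s -> j \in s -> d (h i) (h j) <= 16 * delta).
Context (rZ : forall j, j \in s -> (1 < n j)%N ->
  ratio_on d (Z j) (h j) (rate * ln (n j)%:R) (delta / 2)).
Context (n_gt0 : forall j, j \in s -> (0 < n j)%N).
Context (size_s : (1 < size s)%N).

Let m := map n s.
Let N := sumn m.

Section Largest.
Context (q : nat) (q0 : (0 < q)%N) (qs : (2 ^ q <= size s)%N) (j0 : J).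
Local Notation I := {ffun 'I_q -> bool}.

Let idx (i : I) : J := nth j0 s (enum_rank i).

Let rank_lt (i : I) : (enum_rank i < 2 ^ q)%N.
Proof.
have c : #|{: I}| = (2 ^ q)%N by rewrite card_ffun card_bool card_ord.
by rewrite -[X in (_ < X)%N]c ltn_ord.
Qed.

Let idx_in i : idx i \in s.
Proof. by apply: mem_nth; apply: leq_trans (rank_lt i) qs. Qed.

Let idx_neq i j : i != j -> idx i != idx j.
Proof.
apply: contra; rewrite nth_uniq ?(leq_trans (rank_lt _) qs) // => /eqP e.
by apply/eqP/enum_rank_inj/val_inj.
Qed.

Lemma largest_points (r : R) : 0 < r -> r <= q%:R / 64 ->
  exists h' (Z' : {set T}), [/\ Z' \subset X, h' \in Z' &
    ratio_on d Z' h' r (q%:R * (delta / 2) + delta)].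
Proof.
move=> r0 rq; pose i0 : I := [ffun=> true].
exists (h (idx i0)), (node_union (fun i : I => [set h (idx i)]%SET)); split.
- apply/fintype.subsetP => x /finset.bigcupP[i _]; rewrite inE => /eqP ->.
  by apply: (fintype.subsetP (ZX (idx_in i))); exact/hZ/idx_in.
- by apply/finset.bigcupP; exists i0; rewrite ?inE.
apply: (halving_points dM delta_gt0 q0 (h := fun i => h (idx i)) i0) => //.
- by move=> i j ij; apply: (sepZ (idx_in i) (idx_in j) (idx_neq ij)); exact/hZ/idx_in.
- by move=> i j; apply: diamZ; exact: idx_in.
Qed.

Lemma largest_ratio (r : R) (k : nat) : 0 < r -> (1 < nth 0%N m (2 ^ q).-1)%N ->
  r <= rate * ln (nth 0%N m (2 ^ q).-1)%:R -> (0 < k)%N -> 512 * r <= q%:R * k%:R ->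
  exists h' (Z' : {set T}), [/\ Z' \subset X, h' \in Z' &
    ratio_on d Z' h' (r + r / (4 * k%:R)) (q%:R * k%:R ^+ 2 * (delta / 4) + delta)].
Proof.
move=> r0 n1 rn k0 rqk; pose i0 : I := [ffun=> true].
exists (h (idx i0)), (node_union (fun i : I => Z (idx i))); split.
- apply/fintype.subsetP => x /finset.bigcupP[i _].
  exact/(fintype.subsetP (ZX (idx_in i))).
- by apply/finset.bigcupP; exists i0; rewrite // hZ ?idx_in.
apply: (halving_ratio dM delta_gt0 q0 (Z := fun i => Z (idx i)) (h := fun i => h (idx i))
  i0 (e := fun=> delta / 2)) => //.
- move=> i j x y ij; apply: sepZ; [exact: idx_in|exact: idx_in|exact: idx_neq].
- by move=> i j; apply: diamZ; exact: idx_in.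
move=> i; have le_n : (nth 0%N m (2 ^ q).-1 <= n (idx i))%N.
  rewrite -(nth_map _ 0%N) ?(leq_trans (rank_lt i) qs) //; apply: nth_geq_mono => //.
  by rewrite -ltnS prednK ?expn_gt0 // rank_lt.
apply: (ratio_on_le_r r0) (rZ (idx_in i) _); last exact: leq_trans le_n.
apply: le_trans rn _; rewrite ler_pM2l ?invr_gt0 // ler_ln ?posrE ?ler_nat //.
- by rewrite ltr0n; apply: leq_trans n1.
- by rewrite ltr0n; apply: leq_trans le_n; apply: leq_trans n1.
Qed.

End Largest.

Context (Nmax : nat) (N_le : (N <= Nmax)%N).

Let n0 := nth 0%N m 0.
Let n1 := nth 0%N m 1.

Let m_gt0 k : (k < size s)%N -> (0 < nth 0%N m k)%N.
Proof.
move=> ks; case: s ks n_gt0 @m => // j s' ks n0' /=.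
by rewrite -(map_cons n) (nth_map j) // n0' // mem_nth.
Qed.

Let nth_le_sum k : (nth 0%N m k <= N)%N.
Proof.
rewrite /N sumnE; have [km|km] := ltnP k (size m); last by rewrite nth_default.
rewrite (big_nth 0%N) big_mkord (bigD1 (Ordinal km)) //=.
by rewrite leq_addr.
Qed.

Let rate_gt0 : 0 < rate.
Proof. by rewrite invr_gt0 mulr_gt0. Qed.

Let rateE : 128 * 96 * rate = 1.
Proof. by rewrite /rate divff // mulf_neq0. Qed.

Let ln_le (x y : nat) : (0 < x)%N -> (x <= y)%N -> ln x%:R <= ln y%:R :> R.
Proof.
move=> x0 xy; have y0 := leq_trans x0 xy.
by rewrite ler_ln ?posrE ?ltr0n // ler_nat.
Qed.

Let N_gt0 : (0 < N)%N.
Proof. by apply: leq_trans (m_gt0 _) (nth_le_sum 0); exact: ltnW. Qed.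

Let goal_ratio := exists h' (Z' : {set T}), [/\ Z' \subset X, h' \in Z' &
  ratio_on d Z' h' (rate * ln N%:R) (overhead Nmax * delta)].

Let weaken h' (Z' : {set T}) (r' e' : R) : Z' \subset X -> h' \in Z' ->
  rate * ln N%:R <= r' -> e' <= overhead Nmax * delta -> ratio_on d Z' h' r' e' ->
  0 < rate * ln N%:R -> goal_ratio.
Proof.
move=> ZX' hZ' rr' ee' rZ' r0; exists h', Z'; split=> //.
exact: le_ratio_on ee' (ratio_on_le_r r0 rr' rZ').
Qed.

Let over_ge (r : R) : 0 <= r -> r <= ln N%:R ->
  (400 ^+ 2 * (r ^+ 2 + 1)) * delta <= overhead Nmax * delta.
Proof.
move=> r0 rN; rewrite ler_wpM2r ?(ltW delta_gt0) //; apply: overhead_ge => //.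
  exact: leq_trans N_le.
by apply: le_trans rN _; exact: ln_le.
Qed.

(** The [2 ^ q] largest children all have size above [N / 16 ^ q]. If the ratio of that size is at
    most [q / 256], bare points of these children already reach the target; otherwise halving their
    blocks supplies the missing [q / 3072]. *)
Lemma dyadic_block_ratio q : (0 < q)%N -> (N < 16 ^ q * nth 0%N m (2 ^ q).-1)%N ->
  0 < rate * ln N%:R -> goal_ratio.
Proof.
have delta0 := delta_gt0; have rt0 := rate_gt0; have rtE := rateE.
move=> q0 Nq r0.
have nq0 : (0 < nth 0%N m (2 ^ q).-1)%N.
  by rewrite lt0n; apply: contraTneq Nq => ->; rewrite muln0.
have qs : (2 ^ q <= size s)%N.
  rewrite leqNgt; apply/negP => sq; move: nq0; rewrite nth_default // size_map.
  by rewrite -ltnS prednK ?expn_gt0.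
have j0 : J by case: s size_s => // j s' _; exact: j.
have q0' : 0 < q%:R :> R by rewrite ltr0n.
set nj := nth 0%N m _ in Nq nq0.
have lnN : ln N%:R <= ln nj%:R + q%:R * 4 :> R.
  have : ln N%:R <= ln (16 ^ q * nj)%N%:R :> R by apply: ln_le => //; exact: ltnW.
  rewrite natrM lnM ?posrE ?ltr0n ?expn_gt0 // natrX (_ : 16 = 2 ^+ 4 :> R); last by ring.
  rewrite -exprM lnXn // -[ln 2 *+ _]mulr_natl natrM.
  have := ler_wpM2l (ltW q0') (@ln2_le1 R); lra.
have rN : rate * ln N%:R <= rate * ln nj%:R + q%:R / (32 * 96).
  have := ler_wpM2l (ltW rt0) lnN.
  have -> : rate = (128 * 96)^-1 by [].
  lra.
have lnj0 : 0 <= ln nj%:R :> R by rewrite ln_ge0 // ler1n.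
have [small|big] := leP (rate * ln nj%:R) (q%:R / 256).
  have rq : rate * ln N%:R <= q%:R / 64 by lra.
  have [h' [Z' [ZX' hZ' rZ']]] := largest_points q0 qs j0 r0 rq.
  apply: (weaken ZX' hZ' (lexx _) _ rZ') => //.
  have lnN0 : 0 <= ln N%:R :> R by rewrite ln_ge0 // ler1n.
  apply: le_trans (over_ge lnN0 (lexx _)).
  have qlog : q%:R <= 2 * ln N%:R :> R.
    have qN : (2 ^ q <= N)%N.
      apply: leq_trans qs _; rewrite -(size_map n) -/m /N sumnE -sum1_size.
      rewrite big_seq [leqRHS]big_seq; apply: leq_sum => i /mapP[j js ->].
      exact: n_gt0.
    have : ln (2 ^ q)%N%:R <= ln N%:R :> R by apply: ln_le; rewrite ?expn_gt0.
    rewrite natrX lnXn // -[ln 2 *+ _]mulr_natr.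
    have := @ln2_ge_half R; have := ler_wpM2r (ltW q0') (@ln2_ge_half R); lra.
  have sq : ln N%:R <= ln N%:R ^+ 2 + 1 :> R.
    have := sqr_ge0 (ln N%:R - 1 : R); have := sqr_ge0 (ln N%:R : R); rewrite !expr2; lra.
  have -> : q%:R * (delta / 2) + delta = (q%:R / 2 + 1) * delta by ring.
  rewrite ler_pM2r //; have := sqr_ge0 (ln N%:R : R); lra.
set r1 := rate * ln nj%:R in rN big.
have r10 : 0 < r1 by lra.
have nj1 : (1 < nj)%N.
  rewrite ltn_neqAle nq0 andbT; apply: contraTneq r10 => e1.
  by rewrite /r1 -e1 ln1 mulr0 ltxx.
pose k := (Num.truncn (512 * r1 / q%:R)).+1.
have k0 : (0 < k)%N by [].
have kq : 512 * r1 <= q%:R * k%:R.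
  by rewrite [leRHS]mulrC -ler_pdivrMr // ltW // truncnS_gt.
have kq' : q%:R * k%:R <= 768 * r1.
  have h512 : 0 <= 512 * r1 by lra.
  have /truncn_itv/andP[+ _] := divr_ge0 h512 (ltW q0').
  rewrite ler_pdivlMr // => tq.
  have -> : k%:R = (Num.truncn (512 * r1 / q%:R))%:R + 1 :> R by rewrite natr1.
  lra.
have k0' : 0 < k%:R :> R by rewrite ltr0n.
have [h' [Z' [ZX' hZ' rZ']]] := largest_ratio q0 qs j0 r10 nj1 (lexx _) k0 kq.
apply: (weaken ZX' hZ' _ _ rZ') => //.
  apply: le_trans rN _; rewrite lerD2l ler_pdivlMr; last by rewrite mulr_gt0.
  lra.
have r1N : r1 <= ln N%:R.
  rewrite /r1; have : ln nj%:R <= ln N%:R :> R by apply: ln_le => //; exact: nth_le_sum.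
  have : rate * ln nj%:R <= 1 * ln nj%:R by rewrite ler_wpM2r //; lra.
  lra.
apply: le_trans (over_ge (ltW r10) r1N).
have -> : q%:R * k%:R ^+ 2 * (delta / 4) + delta = (q%:R * k%:R ^+ 2 / 4 + 1) * delta by ring.
rewrite ler_pM2r //.
have : q%:R * k%:R ^+ 2 <= (q%:R * k%:R) ^+ 2 :> R.
  by rewrite exprMn ler_wpM2r ?sqr_ge0 // expr2 ler_peMr ?ler0n // ler1n.
have qk0 : 0 <= q%:R * k%:R :> R by apply: mulr_ge0; exact: ltW.
have := ler_pM qk0 qk0 kq' kq'; rewrite -!expr2.
rewrite exprMn; have := sqr_ge0 r1; lra.
Qed.

(** At most the fraction [t = sqrt (n1 / N)] of the total size lies outside the largest child, so
    its ratio misses the target by a multiple of [t] only; and [2 * ln (t^-1) = ln N - ln n1] bounds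
    [r1 - r2]. The choice of game depends on whether [r2] reaches [r1 / 2]. *)
Lemma two_largest_ratio : (16 * n1 <= N)%N -> N%:R - n0%:R <= Num.sqrt (n1%:R * N%:R) :> R ->
  0 < rate * ln N%:R -> goal_ratio.
Proof.
have delta0 := delta_gt0; have rt0 := rate_gt0; have rtE := rateE.
have c512 : 512 * rate <= 1 / 20 by lra.
have c1024 : 1024 * rate <= 1 by lra.
have c400 : 2 <= 400 ^+ 2 :> R by lra.
move=> n1N Nn0 r0.
have j0 : J by case: s size_s => // j s' _; exact: j.
have lnN0 : 0 <= ln N%:R :> R by rewrite ln_ge0 // ler1n.
have lnN_le : rate * ln N%:R <= ln N%:R by rewrite ler_piMl //; lra.
have [small|big] := leP (rate * ln N%:R) (1 / 64).
  have rq : rate * ln N%:R <= 1%N%:R / 64 by [].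
  have [h' [Z' [ZX' hZ' rZ']]] := @largest_points 1 isT size_s j0 _ r0 rq.
  apply: (weaken ZX' hZ' (lexx _) _ rZ') => //.
  apply: le_trans (over_ge (lexx 0) lnN0); rewrite expr0n add0r mulr1.
  by rewrite mul1r; lra.
have N0 : 0 < N%:R :> R by rewrite ltr0n.
have s0 := ltnW size_s.
have n0p : (0 < n0)%N by exact: m_gt0.
have n1p : (0 < n1)%N by exact: m_gt0.
have n00 : 0 < n0%:R :> R by rewrite ltr0n.
have n10 : 0 < n1%:R :> R by rewrite ltr0n.
pose y : R := n1%:R / N%:R; pose t := Num.sqrt y.
have y0 : 0 < y by rewrite divr_gt0.
have t0 : 0 < t by rewrite sqrtr_gt0.
have tt : t * t = y by rewrite -expr2 sqr_sqrtr // ltW.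
have y16 : y <= (1 / 4) ^+ 2.
  have -> : (1 / 4) ^+ 2 = 1 / 16 :> R by field.
  rewrite /y ler_pdivrMr //.
  by move: n1N; rewrite -(ler_nat R) natrM; lra.
have t4 : t <= 1 / 4.
  have q0 : 0 <= 1 / 4 :> R by [].
  by rewrite -[X in _ <= X](ger0_norm q0) -sqrtr_sqr ler_sqrt ?sqr_ge0.
have sqE : Num.sqrt (n1%:R * N%:R) = t * N%:R.
  have -> : n1%:R * N%:R = y * N%:R ^+ 2 :> R by rewrite /y; field; rewrite gt_eqF.
  by rewrite sqrtrM ?(ltW y0) // sqrtr_sqr ger0_norm // ltW.
rewrite sqE in Nn0.
have n0N : 3 / 4 * N%:R <= n0%:R :> R.
  have := ler_wpM2r (ltW N0) t4; lra.
have lnNn0 : ln N%:R <= ln n0%:R + 4 / 3 * t :> R.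
  have : ln (N%:R / n0%:R) <= N%:R / n0%:R - 1 :> R by apply: ln_le_subr1; rewrite divr_gt0.
  rewrite lnM ?lnV ?posrE ?invr_gt0 //.
  have : N%:R / n0%:R - 1 <= 4 / 3 * t :> R.
    rewrite lerBlDr ler_pdivrMr //.
    have := ler_wpM2l (ltW t0) n0N; lra.
  lra.
have lnt : ln (t^-1) = (ln N%:R - ln n1%:R) / 2 :> R.
  rewrite lnV ?posrE //.
  have : ln y = ln t + ln t by rewrite -tt lnM ?posrE.
  rewrite /y lnM ?lnV ?posrE ?invr_gt0 //; lra.
set r1 := rate * ln n0%:R; set r2 := rate * ln n1%:R.
have r1N : rate * ln N%:R <= r1 + 4 / 3 * rate * t.
  by have := ler_wpM2l (ltW rt0) lnNn0; rewrite /r1; lra.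
have rtt : rate * t <= rate / 4 by rewrite -[leRHS]mul1r mulrCA ler_wpM2l // ltW.
have r1_ge : 1 / 128 <= r1 by lra.
have r10 : 0 < r1 by lra.
have n01 : (n1 <= n0)%N by apply: nth_geq_mono.
have r21 : r2 <= r1 by rewrite /r1 /r2 ler_pM2l // ln_le.
have r2_ge0 : 0 <= r2 by rewrite mulr_ge0 ?(ltW rt0) // ln_ge0 // ler1n.
have r1_lnN : r1 <= ln N%:R.
  by apply: le_trans lnN_le; rewrite ler_pM2l // ln_le //; exact: nth_le_sum.
have diff : 1024 * (r1 - r2) <= 2 * ln (t^-1).
  rewrite lnt /r1 /r2; have : ln n0%:R <= ln N%:R :> R by apply: ln_le => //; exact: nth_le_sum.
  move=> h0; have : rate * (ln n0%:R - ln n1%:R) <= rate * (ln N%:R - ln n1%:R) by rewrite ler_pM2l // lerD2r.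
  have : 0 <= ln N%:R - ln n1%:R :> R by rewrite subr_ge0; apply: ln_le => //; exact: nth_le_sum.
  move=> hp; have := ler_wpM2r hp c1024; lra.
pose a := nth j0 s 0; pose b := nth j0 s 1.
have ain : a \in s by exact: mem_nth.
have bin : b \in s by exact: mem_nth.
have ab : a != b by rewrite nth_uniq.
have na : n a = n0 by rewrite /n0 /m (nth_map j0).
have nb : n b = n1 by rewrite /n1 /m (nth_map j0).
have n0_gt1 : (1 < n0)%N.
  rewrite ltn_neqAle n0p andbT; apply: contraTneq r10 => e1.
  by rewrite /r1 -e1 ln1 mulr0 ltxx.
have ra : ratio_on d (Z a) (h a) r1 (delta / 2).
  by rewrite /r1 -na; apply: rZ => //; rewrite na.
have sepab x z : x \in Z a -> z \in Z b -> delta <= d x z by exact: sepZ.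
have subX (Z' : {set T}) : Z' \subset (Z a :|: Z b)%SET -> Z' \subset X.
  by move=> /fintype.subset_trans; apply; rewrite finset.subUset !ZX.
have [small2|big2] := ltP r2 (r1 / 2).
  pose H := (Num.truncn (64 * r1 + 1)).+1.
  have H1 : 64 * r1 + 1 <= H%:R by rewrite ltW // truncnS_gt.
  have H2 : H%:R <= 64 * r1 + 2.
    have -> : 64 * r1 + 2 = 64 * r1 + 1 + 1 by ring.
    exact: truncnS_le (addr_ge0 (mulr_ge0 (ler0n R 64) (ltW r10)) ler01).
  have [Z' Z'ab rZ'] := run_ratio dM delta_gt0 sepab (diamZ ain bin) ra (hZ bin) r10 (lexx _) H1.
  have h2 : h a \in Z' by have [f [+ _ _ _]] := rZ'.2 1 ltr01.
  apply: (weaken (subX _ Z'ab) h2 _ _ rZ') => //; last first.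
    apply: le_trans (over_ge (lexx 0) lnN0); rewrite expr0n add0r mulr1.
    by rewrite ler_pM2r.
  exact: run_margin r1N r1_ge c512 t0 small2 diff H2.
have r20 : 0 < r2 := lt_le_trans (divr_gt0 r10 (ltr0n R 2)) big2.
have n1_gt1 : (1 < n1)%N.
  rewrite ltn_neqAle n1p andbT; apply: contraTneq r20 => e1.
  by rewrite /r2 -e1 ln1 mulr0 ltxx.
have rb : ratio_on d (Z b) (h b) r2 (delta / 2).
  by rewrite /r2 -nb; apply: rZ => //; rewrite nb.
pose H := (Num.truncn (128 * r1)).+1.
have H1 : 128 * r1 <= H%:R by rewrite ltW // truncnS_gt.
have H2 : H%:R <= 256 * r1.
  apply: le_trans (truncnS_le (mulr_ge0 (ler0n R 128) (ltW r10))) _.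
  have -> : 256 * r1 = 128 * r1 + 128 * r1 by ring.
  by rewrite lerD2l mulrC -ler_pdivrMr.
have H0 : 0 < H%:R :> R by rewrite ltr0n.
have [Z' Z'ab rZ'] := gambler_ratio dM delta_gt0 sepab (diamZ ain bin) ra rb r20 r21 (lexx _) (lexx _) H1.
have h2 : h a \in Z' by have [f [+ _ _ _]] := rZ'.2 1 ltr01.
apply: (weaken (subX _ Z'ab) h2 _ _ rZ') => //; last first.
  apply: le_trans (over_ge (ltW r10) r1_lnN).
  have -> : delta * H%:R ^+ 2 + delta = (H%:R ^+ 2 + 1) * delta by ring.
  rewrite ler_pM2r //.
  have := ler_pM (ltW H0) (ltW H0) H2 H2; rewrite -!expr2.
  rewrite exprMn; have := sqr_ge0 r1; lra.
exact: gambler_margin r1N rtE r20 r21 big2 t0 t4 diff (ltn0Sn _) H2.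
Qed.

End Children.

Lemma node_hard (J : eqType) (s : seq J) (n : J -> nat) (Z : J -> {set T})
    (X : {set T}) (delta : R) (Nmax : nat) :
  0 < delta -> uniq s -> (0 < size s)%N ->
  (forall j, j \in s -> Z j \subset X) ->
  (forall i j x y, i \in s -> j \in s -> i != j -> x \in Z i -> y \in Z j ->
     delta <= d x y) ->
  (forall x y, x \in X -> y \in X -> d x y <= 16 * delta) ->
  (forall j, j \in s -> hard (Z j) (n j) (delta / 2)) ->
  (\sum_(j <- s) n j <= Nmax)%N ->
  hard X (\sum_(j <- s) n j)%N (overhead Nmax * delta).
Proof.
move=> delta0 us s0 ZX sepZ diamX hardZ sum_le.
pose leJ i j := (n j <= n i)%N.
pose s' := sort leJ s.
have ps : perm_eq s' s by rewrite perm_sort.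
have leJ_total : total leJ by move=> i j; exact: leq_total.
have srt : sorted geq (map n s') by rewrite sorted_map sort_sorted.
have sumE : (\sum_(j <- s) n j)%N = sumn (map n s').
  by rewrite sumnE big_map; apply: perm_big; rewrite perm_sym.
have memE := perm_mem ps.
have [t0 _] : exists t0 : T, true.
  by case: s s0 hardZ {us ZX sepZ sum_le s' ps srt sumE memE} => // j s' _ /(_ j (mem_head _ _))[h _]; exists h.
have /boolp.choice[p pP] : forall j, exists q : T * {set T}, j \in s' ->
    [/\ q.2 \subset Z j, q.1 \in q.2, (0 < n j)%N &
    (1 < n j)%N -> ratio_on d q.2 q.1 (rate * ln (n j)%:R) (delta / 2)].
  move=> j.
  have [js|_] := boolP (j \in s'); last by exists (t0, finset.set0).
  by have [|h [Z' hZ']] := hardZ j; [rewrite -memE|exists (h, Z')].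
have subX j : j \in s' -> (p j).2 \subset X.
  move=> js; have [/fintype.subset_trans + _ _ _] := pP _ js; apply.
  by apply: ZX; rewrite -memE.
have n_gt0 j : j \in s' -> (0 < n j)%N by move=> /pP[].
have inX j : j \in s' -> (p j).1 \in X.
  by move=> js; apply: (fintype.subsetP (subX _ js)); have [] := pP _ js.
have [size1|size1] := leqP (size s') 1.
  (* A lone child already has the target ratio and is passed up; only its exit cost is relaxed. *)
  have [j sE] : exists j, s' = [:: j].
    have : size s' = 1%N by apply/eqP; rewrite eqn_leq size1 (perm_size ps).
    by case: (s') => // j [] // _; exists j.
  have js : j \in s' by rewrite sE mem_head.
  have [pZ hp n0 rZ] := pP _ js.
  rewrite sumE sE /= addn0.
  exists (p j).1, (p j).2; split=> //; first exact: subX.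
  move=> n1; apply: le_ratio_on (rZ n1).
  have N1 : (0 < Nmax)%N.
    by apply: leq_trans sum_le; rewrite sumE sE /= addn0.
  have lnN : 0 <= ln Nmax%:R :> R by rewrite ln_ge0 // ler1n.
  have := overhead_ge N1 (lexx 0) lnN; rewrite expr0n add0r mulr1 => ov.
  rewrite mulrC ler_wpM2r ?(ltW delta0) //; lra.
have N1 : (1 < sumn (map n s'))%N.
  case: (s') size1 n_gt0 => // i [//|j u] _ n_gt0 /=.
  rewrite addnA (leq_trans _ (leq_addr _ _)) //.
  have := n_gt0 i; have := n_gt0 j; rewrite !inE !eqxx orbT /= => /(_ isT) + /(_ isT); lia.
have r0 : 0 < rate * ln (sumn (map n s'))%:R.
  by rewrite mulr_gt0 ?invr_gt0 ?mulr_gt0 // ln_gt0 // ltr1n.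
have sN : (sumn (map n s') <= Nmax)%N by rewrite -sumE.
have us' : uniq s' by rewrite sort_uniq.
have hp j : j \in s' -> (p j).1 \in (p j).2 by move=> /pP[].
have sep' i j x y : i \in s' -> j \in s' -> i != j -> x \in (p i).2 -> y \in (p j).2 -> delta <= d x y.
  move=> is' js' ij xi yj; apply: (@sepZ i j); rewrite -?memE //.
    by have [/fintype.subsetP + _ _ _] := pP _ is'; apply.
  by have [/fintype.subsetP + _ _ _] := pP _ js'; apply.
have diam' i j : i \in s' -> j \in s' -> d (p i).1 (p j).1 <= 16 * delta.
  by move=> is' js'; apply: diamX; exact: inX.
have rZ j : j \in s' -> (1 < n j)%N ->
    ratio_on d (p j).2 (p j).1 (rate * ln (n j)%:R) (delta / 2).
  by move=> /pP[].
rewrite sumE.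
have [h' [Z' [ZX' hZ' rZ']]] : exists h' (Z' : {set T}), [/\ Z' \subset X, h' \in Z' &
    ratio_on d Z' h' (rate * ln (sumn (map n s'))%:R) (overhead Nmax * delta)].
  have [[q [q0 Nq]]|[n1N Nn0]] := @dyadic_dichotomy R _ srt.
    exact: (dyadic_block_ratio delta0 us' srt subX hp sep' diam' rZ n_gt0 size1 sN q0 Nq r0).
  exact: (two_largest_ratio delta0 us' srt subX hp sep' diam' rZ n_gt0 size1 sN n1N Nn0 r0).
by exists h', Z'; split=> //; exact: ltnW.
Qed.

End NodeHard.

(** * Ball cutting *)

Section Decomposition.
Context {R : realType} {T : finType} (d : T -> T -> R) (dM : is_metric d).

Definition cball (X : {set T}) (x : T) (r : R) : {set T} :=
  [set y in X | d x y <= r]%SET.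

Lemma cball_sub X x r : cball X x r \subset X.
Proof. by apply/fintype.subsetP => y; rewrite inE => /andP[]. Qed.

Lemma cball_mono X x r r' : r <= r' -> cball X x r \subset cball X x r'.
Proof.
move=> rr'; apply/fintype.subsetP => y; rewrite !inE => /andP[-> /=] h.
exact: le_trans rr'.
Qed.

(* Cutting out a ball around a point with the most populated ball of radius
   [Delta / 8]: among the two annuli of width [Delta / 16] one is thin enough for
   the discarded points to be paid for by the drop of [M]. *)
Lemma ball_decomposition (v : {set T} -> R) (Delta : R) : 0 < Delta ->
  (forall (Q : {set T}) (M : R), Q != finset.set0 ->
     (forall x y, x \in Q -> y \in Q -> d x y <= Delta / 2) ->
     (forall x, x \in Q -> #|cball Q x (Delta / 8)|%:R <= M) ->
     #|Q|%:R <= Num.sqrt M * v Q) ->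
  forall (X : {set T}) (M : R), (forall x, x \in X -> #|cball X x (Delta / 4)|%:R <= M) ->
  exists P : seq {set T}, [/\ uniq P,
    (forall Q, Q \in P -> [/\ Q \subset X, Q != finset.set0 &
       forall x y, x \in Q -> y \in Q -> d x y <= Delta / 2]),
    (forall Q Q' x y, Q \in P -> Q' \in P -> Q != Q' -> x \in Q -> y \in Q' ->
       Delta / 16 <= d x y),
    (\sum_(Q <- P) #|Q| <= #|X|)%N &
    #|X|%:R <= Num.sqrt M * \sum_(Q <- P) v Q].
Proof.
move=> D0 vP X; have [k] := ubnP #|X|; elim: k X => // k IH X Xk M XM.
have [X0|/set0Pn[x0 x0X]] := eqVneq X finset.set0.
  by exists [::]; split=> //; rewrite ?big_nil // X0 cards0 mulr0.
pose F x := #|cball X x (Delta / 8)|.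
pose u := [arg max_(x > x0 in X) F x]%N.
have [uX uF] : u \in X /\ forall x, x \in X -> (F x <= F u)%N.
  by rewrite /u; case: fintype.arg_maxnP => // i iX iF; split.
pose a0 : R := #|cball X u (Delta / 8)|%:R.
pose a1 : R := #|cball X u (3 * Delta / 16)|%:R.
pose a2 : R := #|cball X u (Delta / 4)|%:R.
have uball r : 0 <= r -> u \in cball X u r by move=> r0; rewrite inE uX (dist_xx dM).
have a0_gt0 : 0 < a0.
  by rewrite ltr0n card_gt0; apply/set0Pn; exists u; apply: uball; rewrite divr_ge0 // ltW.
have a02 : a0 <= a2 by rewrite ler_nat subset_leq_card // cball_mono //; lra.
have a2M : a2 <= M by exact: XM.
have s0 : 0 < Num.sqrt a0 by rewrite sqrtr_gt0.
have s2 : 0 < Num.sqrt a2 by rewrite sqrtr_gt0; apply: lt_le_trans a02.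
have e0 : Num.sqrt a0 * Num.sqrt a0 = a0 by rewrite -expr2 sqr_sqrtr // ltW.
have e2 : Num.sqrt a2 * Num.sqrt a2 = a2.
  by rewrite -expr2 sqr_sqrtr // (le_trans (ltW a0_gt0)).
have [rho [rho_ge rho_le cut]] : exists rho : R, [/\ Delta / 8 <= rho, rho <= 3 * Delta / 16 &
    #|cball X u (rho + Delta / 16)|%:R * Num.sqrt a0 <= #|cball X u rho|%:R * Num.sqrt a2].
  (* The growth factors [a1 / a0] and [a2 / a1] have product [a2 / a0], so one of them is at most
     [sqrt (a2 / a0)]. *)
  have [c1|c1] := leP (a1 * Num.sqrt a0) (a0 * Num.sqrt a2).
    exists (Delta / 8); split=> //; first by lra.
    by rewrite (_ : Delta / 8 + Delta / 16 = 3 * Delta / 16) //; field.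
  exists (3 * Delta / 16); split=> //; first by lra.
  rewrite (_ : 3 * Delta / 16 + Delta / 16 = Delta / 4); last by field.
  rewrite -/a2 -/a1 -[X in X * _]e2 mulrAC ler_pM2r //.
  by rewrite ltW // -(ltr_pM2r s0) -mulrA e0 mulrC.
pose Q := cball X u rho; pose B := cball X u (rho + Delta / 16).
have QX : Q \subset X := cball_sub X u rho.
have uQ : u \in Q by apply: uball; lra.
have uB : u \in B by apply: uball; lra.
have Q0 : Q != finset.set0 by apply/set0Pn; exists u.
have diamQ x y : x \in Q -> y \in Q -> d x y <= Delta / 2.
  rewrite !inE => /andP[_ ux] /andP[_ uy].
  by have := dist_tri dM u x y; rewrite (dist_sym dM x u); lra.
have vQ : #|Q|%:R <= Num.sqrt a0 * v Q.
  apply: vP => // x xQ; rewrite ler_nat; apply: leq_trans (uF x _).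
    apply: subset_leq_card; apply/fintype.subsetP => y; rewrite !inE => /andP[/andP[-> _] ->].
    by [].
  exact: (fintype.subsetP QX).
have vQ0 : 0 < v Q.
  rewrite -(pmulr_rgt0 _ s0); apply: lt_le_trans vQ.
  by rewrite ltr0n card_gt0.
(* [B], which includes the discarded annulus, is charged to [Q]: the factor [sqrt (a2 / a0)] turns
   [sqrt a0 * v Q] into [sqrt a2 * v Q], so the losses telescope over the scales. *)
have BM : #|B|%:R <= Num.sqrt M * v Q.
  apply: le_trans (_ : Num.sqrt a2 * v Q <= _); last first.
    by rewrite ler_pM2r // ler_sqrt // (le_trans _ a2M) // ltW // (lt_le_trans a0_gt0).
  rewrite -(ler_pM2r s0); apply: le_trans cut _.
  have := ler_wpM2r (ltW s2) vQ; rewrite -/Q; lra.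
have cardX : (#|X| = #|B| + #|X :\: B|)%N.
  by rewrite -(cardsID B X) (finset.setIidPr _) // cball_sub.
have [||P [uP PX sepP sumP vsum]] := IH (X :\: B) _ M.
- by move: Xk; rewrite cardX ltnS => /(leq_trans _); apply; rewrite -add1n leq_add2r card_gt0; apply/set0Pn; exists u.
- move=> x; rewrite inE => /andP[_ xX]; apply: le_trans (XM x xX).
  rewrite ler_nat subset_leq_card //; apply/fintype.subsetP => y.
  by rewrite !inE => /andP[/andP[_ ->] ->].
have QB : Q \subset B by apply: cball_mono; lra.
have sepQ Q' x y : Q' \in P -> x \in Q -> y \in Q' -> Delta / 16 <= d x y.
  move=> /PX[/fintype.subsetP Q'X _ _] xQ /Q'X; rewrite !inE => /andP[+ yX].
  rewrite yX /= -ltNge => uy; move: xQ; rewrite inE => /andP[_ ux].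
  by have := dist_tri dM x u y; lra.
exists (Q :: P); split.
- rewrite /= uP andbT; apply/negP => /PX[/fintype.subsetP/(_ _ uQ)].
  by rewrite inE uB.
- move=> Q'; rewrite inE => /predU1P[->//|/PX[Q'X Q'0 dQ']]; split=> //.
  by apply: fintype.subset_trans Q'X _; exact: finset.subsetDl.
- move=> Q1 Q2 x y; rewrite !inE => /predU1P[->|Q1P] /predU1P[->|Q2P] Q12 xQ yQ.
  + by rewrite eqxx in Q12.
  + exact: sepQ yQ.
  + by rewrite (dist_sym dM); apply: sepQ xQ.
  + exact: sepP Q12 xQ yQ.
- by rewrite big_cons cardX leq_add // subset_leq_card.
- by rewrite big_cons cardX natrD mulrDr lerD.
Qed.

End Decomposition.

(** * Induction on the scales *)

Section Levels.
Context {R : realType} {T : finType} (d : T -> T -> R) (dM : is_metric d).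

Lemma hard_mono (X Y : {set T}) n (e e' : R) : X \subset Y -> e <= e' ->
  hard d X n e -> hard d Y n e'.
Proof.
move=> XY ee' [h [Z [ZX hZ n0 rZ]]]; exists h, Z; split=> //.
  exact: fintype.subset_trans XY.
by move=> n1; exact: le_ratio_on ee' (rZ n1).
Qed.

Context (h : nat) (h0 : (0 < h)%N) (h_large : 2 * overhead #|T| <= 2 ^+ h :> R).
Context (d0 : R) (d0_gt0 : 0 < d0) (d0_lt : forall x y, x != y -> d0 < d x y).

Definition scale (l : nat) : R := d0 * 2 ^+ l.

(* Exit cost allowed at level [l] for the residue [s]: it is proportional to the
   scale of the last level congruent to [s] modulo [h]. *)
Definition exit_cost (l : nat) (s : 'I_h) : R :=
  overhead #|T| * (scale l / 16) / 2 ^+ ((l + (h - s)) %% h).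

Lemma scaleS l : scale l.+1 = 2 * scale l.
Proof. by rewrite /scale exprS; ring. Qed.

Lemma scale_gt0 l : 0 < scale l.
Proof. by rewrite mulr_gt0 // exprn_gt0. Qed.

Lemma exit_costS l (s : 'I_h) : ~~ (h %| l.+1 + (h - s))%N ->
  exit_cost l.+1 s = exit_cost l s.
Proof.
move=> nd; rewrite /exit_cost scaleS addSn modnS -addSn (negPf nd) exprS.
by field; rewrite expf_neq0.
Qed.

(** Just before its turn a residue has waited [h - 1] levels, and by [h_large] its exit cost has
    become at most half of the new separation [scale l.+1 / 16], which is what [node_hard] asks of
    children. *)
Lemma exit_cost_branch l (s : 'I_h) : (h %| l.+1 + (h - s))%N ->
  exit_cost l.+1 s = overhead #|T| * (scale l.+1 / 16) /\
  exit_cost l s <= scale l.+1 / 16 / 2.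
Proof.
move=> hd; split; first by rewrite /exit_cost (eqP hd) expr0 divr1.
rewrite /exit_cost.
have -> : ((l + (h - s)) %% h = h.-1)%N.
  move: hd; rewrite addSn => /eqP; rewrite modnS; case: ifP => // + _.
  move=> /dvdnP[k kE]; have k0 : (0 < k)%N by case: k kE.
  have -> : (l + (h - s) = k.-1 * h + h.-1)%N.
    by apply: succn_inj; rewrite kE -addnS prednK // -mulSnr prednK.
  by rewrite modnMDl modn_small // prednK.
have sc := scale_gt0 l; rewrite scaleS ler_pdivrMr ?exprn_gt0 //.
have -> : 2 * scale l / 16 / 2 * 2 ^+ h.-1 = scale l / 16 / 2 * 2 ^+ h :> R.
  by rewrite -[in RHS](prednK h0) exprS; field.
have : scale l / 16 / 2 * (2 * overhead #|T|) <= scale l / 16 / 2 * 2 ^+ h.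
  by rewrite ler_wpM2l ?divr_ge0 // ltW.
lra.
Qed.

Lemma branch_residue l (s : 'I_h) :
  (h %| l.+1 + (h - s))%N = (s == Ordinal (ltn_pmod l.+1 h0)).
Proof.
have sh := ltn_ord s.
rewrite -val_eqE /= /dvdn -modnDml; set r := (l.+1 %% h)%N.
have rh : (r < h)%N by rewrite ltn_pmod.
have [srE|sr|sr] := ltngtP s r.
- have -> : (r + (h - s) = (r - s) + h)%N by lia.
  by rewrite modnDr modn_small; lia.
- by rewrite modn_small; lia.
- by rewrite sr subnKC ?modnn // ltnW.
Qed.

Definition max_ball (X : {set T}) (r : R) : nat := (\max_(x in X) #|cball d X x r|)%N.

Lemma card_le_max_ball (X : {set T}) x r : x \in X -> (#|cball d X x r| <= max_ball X r)%N.
Proof. by move=> xX; rewrite /max_ball (bigD1 x) //= leq_maxl. Qed.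

Lemma max_ball_le (X : {set T}) r (M : R) : X != finset.set0 ->
  (forall x, x \in X -> #|cball d X x r|%:R <= M) -> (max_ball X r)%:R <= M.
Proof.
move=> /set0Pn[x xX] XM; have X0 : (0 < #|X|)%N by rewrite card_gt0; apply/set0Pn; exists x.
rewrite /max_ball; have [y yX ->] := eq_bigmax_cond (fun x => #|cball d X x r|) X0.
exact: XM.
Qed.

(** At level [l.+1] only the residue of [l.+1] merges the pieces, adding up their sizes; every other
    residue keeps its best piece. The sum over the pieces of the products of sizes is at most that
    sum times the product of the maxima. Level 0 consists of single points, since [d0] is below all
    distances. *)
Lemma level_hard l (X : {set T}) : X != finset.set0 ->
  (forall x y, x \in X -> y \in X -> d x y <= scale l) ->
  exists n : 'I_h -> nat,
    (forall s, hard d X (n s) (exit_cost l s) /\ (n s <= #|X|)%N) /\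
    #|X|%:R <= Num.sqrt (max_ball X (scale l / 4))%:R * \prod_s (n s)%:R :> R.
Proof.
have dlt := d0_lt; have d00 := d0_gt0.
elim: l X => [|l IH] X X0 diamX.
  have /set0Pn[x xX] := X0.
  have XE : X = [set x]%SET.
    apply/setP => y; rewrite inE; apply/idP/eqP => [yX|->//].
    apply/eqP; apply: contraT => yx; have := dlt _ _ yx.
    by rewrite ltNge; have := diamX _ _ yX xX; rewrite /scale expr0 mulr1 => ->.
  exists (fun=> 1%N); split=> [s|].
    split; last by rewrite XE cards1.
    by exists x, X; split.
  rewrite big1 // mulr1 XE cards1 -[leLHS]sqrtr1 ler_sqrt // ler1n.
  have x1 : x \in [set x]%SET by rewrite inE.
  apply: leq_trans (card_le_max_ball (scale 0 / 4) x1).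
  rewrite card_gt0; apply/set0Pn; exists x.
  by rewrite !inE eqxx (dist_xx dM) divr_ge0 // ltW // scale_gt0.
have sc := scale_gt0 l.+1; have scE := scaleS l.
have /boolp.choice[n nP] : forall Q : {set T}, exists n : 'I_h -> nat, Q != finset.set0 ->
    (forall x y, x \in Q -> y \in Q -> d x y <= scale l) ->
    (forall s, hard d Q (n s) (exit_cost l s) /\ (n s <= #|Q|)%N) /\
    #|Q|%:R <= Num.sqrt (max_ball Q (scale l / 4))%:R * \prod_s (n s)%:R :> R.
  move=> Q; have [Q0|Q0] := eqVneq Q finset.set0; first by exists (fun=> 0%N).
  have [dQ|nQ] := pselect (forall x y, x \in Q -> y \in Q -> d x y <= scale l); last by exists (fun=> 0%N).
  by have [n nP] := IH Q Q0 dQ; exists n.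
have half : scale l.+1 / 2 = scale l by rewrite scE; field.
have eighth : scale l.+1 / 8 = scale l / 4 by rewrite scE; field.
pose v (Q : {set T}) : R := \prod_s (n Q s)%:R.
have v0 Q : 0 <= v Q by apply: prodr_ge0.
have vP (Q : {set T}) (M : R) : Q != finset.set0 ->
     (forall x y, x \in Q -> y \in Q -> d x y <= scale l.+1 / 2) ->
     (forall x, x \in Q -> #|cball d Q x (scale l.+1 / 8)|%:R <= M) ->
     #|Q|%:R <= Num.sqrt M * v Q.
  rewrite half eighth => Q0 dQ bQ; have [_ nQ] := nP Q Q0 dQ.
  apply: le_trans nQ _; rewrite ler_wpM2r ?v0 //.
  by have := max_ball_le Q0 bQ; exact: ler_wsqrtr.
have maxP x : x \in X ->
    #|cball d X x (scale l.+1 / 4)|%:R <= (max_ball X (scale l.+1 / 4))%:R :> R.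
  by move=> xX; rewrite ler_nat card_le_max_ball.
have [P [uP PX sepP sumP Xle]] := ball_decomposition dM sc vP maxP.
have P0 : (0 < size P)%N.
  case: (P) Xle => // /[!big_nil] /[!mulr0]; rewrite lern0 cards_eq0.
  by rewrite (negPf X0).
have nPP Q : Q \in P -> forall s, hard d Q (n Q s) (exit_cost l s) /\ (n Q s <= #|Q|)%N.
  by move=> /PX[_ Q0]; rewrite half => dQ; have [] := nP Q Q0 dQ.
pose s0 := Ordinal (ltn_pmod l.+1 h0).
pose N s := if s == s0 then (\sum_(Q <- P) n Q s0)%N else (\max_(Q <- P) n Q s)%N.
exists N; split.
  move=> s; rewrite /N; have [->|ss0] := eqVneq s s0.
    have hd : (h %| l.+1 + (h - s0))%N by rewrite branch_residue.
    have [eE e_le] := exit_cost_branch hd.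
    have sumN : (\sum_(Q <- P) n Q s0 <= \sum_(Q <- P) #|Q|)%N.
      by rewrite big_seq [leqRHS]big_seq; apply: leq_sum => Q QP; have [] := nPP Q QP s0.
    split; last exact: leq_trans sumP.
    rewrite eE; apply: (node_hard dM (Z := id)) => //.
    - by rewrite divr_gt0.
    - by move=> Q /PX[].
    - by move=> x y xX yX; apply: le_trans (diamX _ _ xX yX) _; lra.
    - by move=> Q QP; have [+ _] := nPP Q QP s0; exact: hard_mono.
    - by apply: leq_trans (leq_trans sumN sumP) _; exact: max_card.
  have nd : ~~ (h %| l.+1 + (h - s))%N by rewrite branch_residue.
  have [Q QP ->] : exists2 Q, Q \in P & (\max_(Q <- P) n Q s)%N = n Q s.
    elim: (P) P0 => // Q [|Q' P'] IHP _; first by exists Q; rewrite ?mem_head // big_seq1.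
    have [Q1 Q1P E1] := IHP isT; rewrite big_cons E1.
    have [le12|lt21] := leqP (n Q s) (n Q1 s).
      by exists Q1; rewrite ?(maxn_idPr le12) // inE Q1P orbT.
    by exists Q; rewrite ?mem_head // (maxn_idPl (ltnW lt21)).
  have [hQ nQ] := nPP Q QP s; have [QX _ _] := PX Q QP.
  split; last by apply: leq_trans nQ _; exact: subset_leq_card.
  by apply: hard_mono hQ; rewrite // exit_costS.
apply: le_trans Xle _; rewrite ler_wpM2l ?sqrtr_ge0 //.
rewrite [leRHS](bigD1 s0) //= {1}/N eqxx natr_sum mulr_suml.
rewrite big_seq [leRHS]big_seq; apply: ler_sum => Q QP.
rewrite /v (bigD1 s0) //= ler_wpM2l //.
apply: ler_prod => s ss0; rewrite ler0n /= ler_nat /N (negPf ss0).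
by rewrite (bigD1_seq Q) //= leq_maxl.
Qed.

End Levels.

Section MetricHard.
Context {R : realType} {T : finType} (d : T -> T -> R) (dM : is_metric d).

Lemma dist_lower_bound : exists2 d0 : R, 0 < d0 & forall x y, x != y -> d0 < d x y.
Proof.
pose b : R := \big[Num.min/1]_(p : T * T | p.1 != p.2) d p.1 p.2.
have b0 : 0 < b by apply/bigmin_gtP; split=> // -[x y] /=; exact: dist_gt0.
exists (b / 2); first by rewrite divr_gt0.
move=> x y xy; apply: lt_le_trans (_ : b <= _); first by lra.
exact: (bigmin_le_cond _ (fun p : T * T => d p.1 p.2) (xy : (x, y).1 != (x, y).2)).
Qed.

Lemma dist_upper_bound : exists2 D : R, 0 < D & forall x y, d x y <= D.
Proof.
have s0 : 0 <= \sum_(p : T * T) d p.1 p.2 by apply: sumr_ge0 => p _; exact: dist_ge0.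
exists (1 + \sum_(p : T * T) d p.1 p.2); first by lra.
move=> x y; rewrite (bigD1 (x, y)) //=.
have : 0 <= \sum_(p : T * T | p != (x, y)) d p.1 p.2.
  by apply: sumr_ge0 => p _; exact: dist_ge0.
lra.
Qed.

(** At the top no ball holds more than [#|T|] points, so the product of the [h] sizes is at least
    [sqrt #|T|], and the largest size is at least the [h]-th root of that. *)
Lemma metric_hard (h : nat) : (0 < h)%N -> 2 * overhead #|T| <= 2 ^+ h :> R ->
  (1 < #|T|)%N ->
  exists n e, hard d [set: T]%SET n e /\ ln #|T|%:R / (2 * h%:R) <= ln n%:R :> R.
Proof.
move=> h0 h_large T1.
have [d0 d0_gt0 d0_lt] := dist_lower_bound.
have [D D0 D_ge] := dist_upper_bound.
have T0 : [set: T]%SET != finset.set0 by rewrite -card_gt0 cardsT ltnW.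
pose l := (Num.truncn (D / d0)).+1.
have D_le x y : d x y <= scale d0 l.
  apply: le_trans (D_ge x y) _; rewrite /scale -ler_pdivrMl // mulrC.
  apply: le_trans (_ : l%:R <= _); first by rewrite ltW // truncnS_gt.
  by rewrite -natrX ler_nat ltnW // ltn_expl.
have [n [nP nT]] := level_hard dM h0 h_large d0_gt0 d0_lt T0 (fun x y _ _ => D_le x y).
pose s := [arg max_(i > Ordinal h0) n i]%N.
have n_le i : (n i <= n s)%N by rewrite /s; case: arg_maxnP => // j _; exact.
have [hs _] := nP s; exists (n s); eexists; split; first exact: hs.
have ns0 : (0 < n s)%N by have [[? [? []]]] := nP s.
have T0' : 0 < #|T|%:R :> R by rewrite ltr0n ltnW.
have sq0 : 0 < Num.sqrt #|T|%:R :> R by rewrite sqrtr_gt0.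
have prod_le : \prod_i (n i)%:R <= (n s)%:R ^+ h :> R.
  rewrite -[X in _ ^+ X](card_ord h) -prodr_const; apply: ler_prod => i _.
  by rewrite ler0n ler_nat n_le.
have sqT : Num.sqrt #|T|%:R <= (n s)%:R ^+ h :> R.
  apply: le_trans prod_le; rewrite -(ler_pM2l sq0) -expr2 sqr_sqrtr ?ler0n //.
  rewrite cardsT in nT; apply: le_trans nT _; rewrite ler_wpM2r ?prodr_ge0 //.
  rewrite ler_sqrt ?ler0n // ler_nat /max_ball; apply/bigmax_leqP => x _.
  exact: max_card.
have lnT : ln #|T|%:R = 2 * ln (Num.sqrt #|T|%:R) :> R.
  have -> : #|T|%:R = Num.sqrt #|T|%:R * Num.sqrt #|T|%:R :> R.
    by rewrite -expr2 sqr_sqrtr ?ler0n.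
  rewrite lnM ?posrE // -expr2 sqrtr_sqr ger0_norm ?ltW //; ring.
have hR : 0 < h%:R :> R by rewrite ltr0n.
rewrite ler_pdivrMr ?mulr_gt0 // lnT.
have : ln (Num.sqrt #|T|%:R) <= ln ((n s)%:R ^+ h) :> R.
  by rewrite ler_ln ?posrE ?exprn_gt0 ?ltr0n.
rewrite lnXn ?ltr0n // -mulr_natl; lra.
Qed.

End MetricHard.

(** * From the hole to the servers *)

Section PointLevel.
Context {R : realType} {T : finType} (d : T -> T -> R) (dM : is_metric d).

Fixpoint requests (s : seq T) : adversary R T :=
  if s is x :: s' then Request x (requests s') else Stop.

Lemma mean_requests s F : mean (requests s) F = F s.
Proof. by elim: s F => //= x s IH F; rewrite IH. Qed.

Lemma mean_play_requests (c : T -> seq T) s F :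
  mean (play (fun x => requests (c x)) s) F = F (flatten (map c s)).
Proof.
elim: s F => //= x s IH F; rewrite mean_andthen mean_requests IH.
by [].
Qed.

Lemma requests_cat s1 s2 : requests (s1 ++ s2) = andthen (requests s1) (requests s2).
Proof. by elim: s1 => //= x s1 ->. Qed.

Lemma value_lip (Y : {set T}) (a : adversary R T) (w : T -> R) x y : (1 < #|Y|)%N ->
  fair_on (fun x => x \in Y) a ->
  (forall x y, x \in Y -> y \in Y -> w x <= w y + d x y) ->
  x \in Y -> y \in Y -> value d Y a w x <= value d Y a w y + d x y.
Proof.
move=> Y1 + wlip; elim: a x y => /= [|z a IH|p a1 IH1 a2 IH2] x y.
- by move=> _; exact: wlip.
- move=> [zY fa] xY yY; have [->|xz] := eqVneq x z; have [->|yz] := eqVneq y z.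
  + by rewrite (dist_xx dM) addr0.
  + rewrite (dist_sym dM z y); apply: (nearest_le d (value d Y a w)).
    by rewrite !inE yz.
  + have [u + ->] := nearestP d z (value d Y a w) z Y1.
    rewrite !inE => /andP[uz uY]; have := IH x u fa xY uY.
    by have := dist_tri dM z x u; rewrite (dist_sym dM z u); lra.
  + exact: IH.
- move=> [/andP[p0 p1] f1 f2] xY yY.
  have q0 : 0 <= 1 - p by lra.
  have := ler_wpM2l p0 (IH1 x y f1 xY yY); have := ler_wpM2l q0 (IH2 x y f2 xY yY); lra.
Qed.

(** * Confining the hole to a subset [Y] by repeated requests *)

Section Cycle.
Context (Y : {set T}) (Y1 : (1 < #|Y|)%N) (d0 D : R) (d0_gt0 : 0 < d0).
Context (d0_le : forall x y, x != y -> d0 <= d x y) (D_ge : forall x y, d x y <= D).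
Context (L : nat) (L_ge : 3 * D <= d0 *+ L).

(* Requesting all points of [forbidden x] over and over leaves the hole no
   choice but to move into [Y :\ x], or to pay at least [d0] per round. *)
Definition forbidden (x : T) : {set T} := (~: (Y :\ x))%SET.

Definition cycle (x : T) : seq T := flatten (nseq L (enum (forbidden x))).

Lemma mem_cycle x y : y \in cycle x -> y \in forbidden x.
Proof.
rewrite /cycle; elim: L => //= n IH; rewrite mem_cat mem_enum => /orP[//|]; exact: IH.
Qed.

Let t x (w : T -> R) z := nearest d Y x w z.

Let t_lip x w z u : t x w z <= t x w u + d u z.
Proof.
rewrite /t; have [y yY ->] := nearestP d x w u Y1.
apply: le_trans (nearest_le d w z yY) _.
by have := dist_tri dM u y z; lra.
Qed.

(** [t x w z] is the price of moving from [z] into [Y :\ x], and [b] bounds the price of dodging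
    among forbidden points. A hit hole either pays the former or moves to a forbidden point for at
    least [d0], so a full round lifts [b] by [d0]. *)
Lemma cycle_round x (w G : T -> R) b s :
  {subset s <= forbidden x} ->
  (forall y, y \in Y :\ x -> w y <= G y) ->
  (forall z, z \in forbidden x -> Num.min (t x w z) b <= G z) ->
  [/\ forall y, y \notin forbidden x -> value d [set: T]%SET (requests s) G y = G y,
      forall z, z \in forbidden x -> Num.min (t x w z) b <= value d [set: T]%SET (requests s) G z &
      forall z, z \in s -> Num.min (t x w z) (b + d0) <= value d [set: T]%SET (requests s) G z].
Proof.
have d00 := d0_gt0; have dle := d0_le.
move=> + wG tG; elim: s => [|z s IH] sub; first by split.
have [|h1 h2 h3] := IH; first by move=> y ys; apply: sub; rewrite inE ys orbT.
have zF : z \in forbidden x by apply: sub; rewrite mem_head.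
have T1 : (1 < #|[set: T]%SET|)%N.
  by rewrite cardsT; apply: leq_trans Y1 _; exact: max_card.
set G1 := value d [set: T]%SET (requests s) G in h1 h2 h3.
have new : Num.min (t x w z) (b + d0) <= nearest d [set: T]%SET z G1 z.
  apply: le_nearest => // u; rewrite !inE andbT => uz.
  have [uF|uF] := boolP (u \in forbidden x).
    have := h2 u uF; have := t_lip x w z u; have := dle u z uz.
    rewrite !ge_min => h4 h5 /orP[h6|h6]; apply/orP; [left|right]; lra.
  rewrite h1 // ge_min; apply/orP; left.
  have uY : u \in Y :\ x by move: uF; rewrite !inE negbK.
  by apply: le_trans (nearest_le d w z uY) _; rewrite lerD2r wG.
have min_le : Num.min (t x w z) b <= Num.min (t x w z) (b + d0).
  by rewrite le_min !ge_min lexx /= lerDl (ltW d00) orbT.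
split=> [y yF|y yF|y] /=.
- by case: eqP => [yz|_]; [rewrite yz zF in yF|exact: h1].
- case: eqP => [->|_]; last exact: h2.
  exact: le_trans new.
- by rewrite inE; case: eqP => [->|_] //= ys; exact: h3.
Qed.

Lemma cycle_rounds x (w G : T -> R) b n :
  (forall y, y \in Y :\ x -> w y <= G y) ->
  (forall z, z \in forbidden x -> Num.min (t x w z) b <= G z) ->
  let G' := value d [set: T]%SET (requests (flatten (nseq n (enum (forbidden x))))) G in
  (forall y, y \in Y :\ x -> w y <= G' y) /\
  (forall z, z \in forbidden x -> Num.min (t x w z) (b + d0 *+ n) <= G' z).
Proof.
move=> wG tG /=; elim: n => [|n [IH1 IH2]] /=; first by rewrite mulr0n addr0.
rewrite requests_cat value_andthen.
set G1 := value _ _ (requests (flatten _)) G in IH1 IH2.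
have sub : {subset enum (forbidden x) <= forbidden x} by move=> y; rewrite mem_enum.
have [h1 h2 h3] := cycle_round sub IH1 IH2; split=> [y yY|z zF].
  by rewrite h1 ?IH1 //; move: yY; rewrite !inE negbK.
by rewrite mulrSr addrA; apply: h3; rewrite mem_enum.
Qed.

Lemma cycle_value x (w G : T -> R) : x \in Y ->
  (forall y z, y \in Y -> z \in Y -> w y <= w z + d y z) ->
  (forall y, y \in Y -> w y <= G y) ->
  (forall z y, z \notin Y -> y \in Y -> w y <= G z + D) ->
  let w' := value d Y (Request x Stop) w in
  let G' := value d [set: T]%SET (requests (cycle x)) G in
  (forall y, y \in Y -> w' y <= G' y) /\
  (forall z y, z \notin Y -> y \in Y -> w' y <= G' z + D).
Proof.
have d00 := d0_gt0; have Dle := D_ge; have Lge := L_ge.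
move=> xY wlip wG outG w' G'.
(* The rounds lift [b] from [w x - D] to at least [w x + 2 * D], above every [t x w z]; this is the
   origin of [3 * D] in [L_ge]. *)
have tG z : z \in forbidden x -> Num.min (t x w z) (w x - D) <= G z.
  move=> zF; rewrite ge_min; apply/orP; right.
  have [zY|zY] := boolP (z \in Y); last by have := outG z x zY xY; lra.
  by have := wG z zY; have := wlip x z xY zY; have := Dle x z; lra.
have wG' y : y \in Y :\ x -> w y <= G y by rewrite !inE => /andP[_ /wG].
have [g1 g2] := cycle_rounds L wG' tG.
rewrite -/(cycle x) -/G' in g1 g2.
have gt z : z \in forbidden x -> t x w z <= G' z.
  move=> zF; apply: le_trans (g2 z zF); rewrite le_min lexx /=.
  have [u uY] := nearestP d x w x Y1; rewrite /t => _.
  apply: le_trans (nearest_le d w z uY) _.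
  move: uY; rewrite !inE => /andP[_ uY].
  by have := wlip u x uY xY; have := Dle u x; have := Dle u z; lra.
have xF : x \in forbidden x by rewrite !inE eqxx.
have w'E y : w' y = if y == x then t x w x else w y by [].
split=> [y yY|z y zY yY].
  rewrite w'E; case: eqP => [->|/eqP yx]; first exact: gt.
  by apply: g1; rewrite !inE yx.
have zF : z \in forbidden x by rewrite !inE (negPf zY) andbF.
apply: le_trans (_ : t x w z + D <= _); last by rewrite lerD2r gt.
rewrite /t; have [u uY ->] := nearestP d x w z Y1.
have duz := dist_ge0 dM u z; move: (uY); rewrite !inE => /andP[ux uY'].
rewrite w'E; case: eqP => [_|/eqP yx].
  by have := nearest_le d w x uY; have := Dle u x; rewrite /t; lra.
by have := wlip y u yY uY'; have := Dle y u; lra.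
Qed.

(** In the full space the hole may stray outside [Y]. The second claim carries the induction there
    with a loss [D] that does not accumulate, because each cycle restores the exact bound. *)
Lemma expand_value a : fair_on (fun x => x \in Y) a ->
  (forall y, y \in Y -> value d Y a (fun=> 0) y <=
     value d [set: T]%SET (expand (fun x => requests (cycle x)) a) (fun=> 0) y) /\
  (forall z y, z \notin Y -> y \in Y -> value d Y a (fun=> 0) y <=
     value d [set: T]%SET (expand (fun x => requests (cycle x)) a) (fun=> 0) z + D).
Proof.
have Dle := D_ge.
elim: a => /= [_|x a IH [xY fa]|p a1 IH1 a2 IH2 [/andP[p0 p1] f1 f2]].
- split=> // z y _ yY; rewrite add0r; apply: le_trans (Dle y y).
  exact: dist_ge0.
- have [i1 i2] := IH fa; rewrite value_andthen.
  apply: cycle_value => // y z; apply: value_lip => // y' z' _ _.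
  by rewrite add0r; exact: dist_ge0.
- have [i1 i2] := IH1 f1; have [j1 j2] := IH2 f2; have q0 : 0 <= 1 - p by lra.
  split=> [y yY|z y zY yY].
    by apply: lerD; rewrite ler_wpM2l // ?i1 ?j1.
  have := ler_wpM2l p0 (i2 z y zY yY); have := ler_wpM2l q0 (j2 z y zY yY); lra.
Qed.

Lemma offline_avoid s r g h' : g \notin s ->
  (1 < #|[set: T]%SET|)%N ->
  offline d [set: T]%SET (s ++ r) g h' <= offline d [set: T]%SET r g h'.
Proof.
move=> + T1; elim: s => //= x s IH; rewrite inE negb_or => /andP[gx gs].
apply: le_trans (IH gs); rewrite -[leRHS]addr0 -(dist_xx dM g).
by apply: (nearest_le d (fun g => offline d [set: T]%SET (s ++ r) g h')); rewrite !inE gx.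
Qed.

(** A hole in [Y :\ x] is hit by no point of [cycle x], so the path chosen against the single
    request [x] survives the whole cycle. *)
Lemma offline_cycle s h h' :
  offline d [set: T]%SET (flatten (map cycle s)) h h' <= offline d Y s h h'.
Proof.
have T1 : (1 < #|[set: T]%SET|)%N.
  by rewrite cardsT; apply: leq_trans Y1 _; exact: max_card.
elim: s h => //= x s IH h.
have [g gY ->] := nearestP d x (fun g => offline d Y s g h') h Y1.
apply: le_trans (offline_lip dM _ h g h' T1) _.
rewrite addrC (dist_sym dM h g) lerD2r; apply: le_trans (IH g).
apply: offline_avoid => //; apply/negP => /mem_cycle; rewrite !inE.
by move: gY; rewrite !inE => ->.
Qed.

End Cycle.
End PointLevel.

Section Servers.
Context {R : realType} {M : metricType R} {K : nat} (p : 'I_K.+1 -> M) (p_inj : injective p).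
Local Notation T := 'I_K.+1.
Local Notation config := (Defs.config M K).

Definition point_dist (i j : T) : R := mdist (p i) (p j).
Local Notation d := point_dist.

Lemma point_dist_metric : is_metric d.
Proof.
split=> [x|x y|y x z|x y xy].
- exact: mdistxx.
- exact: metric_sym.
- exact: metric_triangle.
- by rewrite mdist_gt0; apply: contra_neq xy => /p_inj.
Qed.

(* [f] is a lazy copy of the configuration: server [i] stands at [p (f i)], and
   [u] is the only point left uncovered. *)
Definition shadow (f : 'I_K -> T) (u : T) : Prop :=
  injective f /\ forall i, f i != u.

Definition lag (C : config) (f : 'I_K -> T) : R := \sum_i mdist (C i) (p (f i)).

Lemma lag_ge0 C f : 0 <= lag C f.
Proof. by apply: sumr_ge0 => i _; exact: mdist_ge0. Qed.

Lemma lag_move (C C' : config) f :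
  lag C' f <= lag C f + \sum_i mdist (C i) (C' i).
Proof.
rewrite /lag -big_split; apply: ler_sum => i _ /=.
by rewrite addrC (metric_sym (C i) (C' i)); exact: metric_triangle.
Qed.

Lemma shadow_swap f u a b : shadow f u -> shadow (tperm a b \o f) (tperm a b u).
Proof.
move=> [finj fu]; split; first exact: inj_comp perm_inj finj.
by move=> i /=; rewrite (inj_eq perm_inj).
Qed.

Lemma shadow_onto f u x : shadow f u -> x != u -> exists i, f i = x.
Proof.
move=> [finj fu] xu; apply: contrapT => fx.
pose A := [set f i | i : 'I_K]%SET.
have cA : #|A| = K by rewrite card_imset // card_ord.
have : A \subset (~: [set x; u])%SET.
  apply/fintype.subsetP => y /imsetP[i _ ->]; rewrite !inE negb_or fu andbT.
  by apply/negP => /eqP fix_; apply: fx; exists i.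
move=> /subset_leq_card; rewrite cA.
have := cardsC [set x; u]%SET; rewrite cards2 xu card_ord; lia.
Qed.

(** Server [i0] stands on the request, so its copy is exchanged with whatever occupies [z]. If that
    is the hole, it moves to [f i0], and the term [d z (f i0)] leaving the lag pays for this; if it
    is another copy, the triangle inequality through [p z] shows that the lag does not grow. *)
Lemma shadow_serve (C : config) (z : T) f u : shadow f u -> (exists i, C i = p z) ->
  exists f' u', [/\ shadow f' u', u' != z, u != z -> u' = u & d u u' + lag C f' <= lag C f].
Proof.
move=> fu [i0 Ci0]; have [finj fhole] := fu; pose a := f i0.
exists (tperm a z \o f), (tperm a z u).
have au : a != u := fhole i0.
have lagE g : lag C g = d z (g i0) + \sum_(i | i != i0) mdist (C i) (p (g i)).
  by rewrite /lag (bigD1 i0) //= Ci0.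
have d0E : d z ((tperm a z \o f) i0) = 0 by rewrite /= tpermL; exact: mdistxx.
split; first exact: shadow_swap.
- by rewrite -{2}(tpermL a z) (inj_eq perm_inj) eq_sym.
- by move=> uz; rewrite tpermD // eq_sym.
rewrite !lagE d0E add0r.
have fia i : i != i0 -> f i != a by move=> ii0; rewrite (inj_eq finj).
have [uz|uz] := eqVneq u z.
  rewrite uz tpermR lerD2l; apply: ler_sum => i ii0 /=.
  by rewrite tpermD // 1?eq_sym ?fia // -uz fhole.
rewrite tpermD // 1?eq_sym // [d u u]mdistxx add0r.
have [[j fj]|nz] := pselect (exists j, f j = z); last first.
  rewrite -[leLHS]add0r lerD ?mdist_ge0 //; apply: ler_sum => i ii0 /=.
  rewrite tpermD // 1?eq_sym ?fia //.
  by apply/negP => /eqP fz; apply: nz; exists i.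
have [ji0|ji0] := eqVneq j i0.
  rewrite -[leLHS]add0r lerD ?mdist_ge0 //; apply: ler_sum => i ii0 /=.
  by rewrite /a -ji0 fj tperm1 perm1.
rewrite (bigD1 j) //= [X in _ <= _ + X](bigD1 j) //= fj tpermR addrA lerD //.
  by rewrite addrC; exact: metric_triangle.
apply: ler_sum => i /andP[ii0 ij] /=.
rewrite tpermD // 1?eq_sym ?fia // -fj.
by rewrite (inj_eq finj).
Qed.

Fixpoint cost_after (A : seq M -> config) (pre s : seq M) : R :=
  if s is x :: s' then
    \sum_i mdist (A pre i) (A (rcons pre x) i) + cost_after A (rcons pre x) s'
  else 0.

Lemma cost_alg_after A s : cost_alg A s = cost_after A [::] s.
Proof.
rewrite /cost_alg /movement_cost /online_schedule.
suff gen pre : \sum_(t < size s) \sum_i mdist (A (pre ++ take t s) i) (A (pre ++ take t.+1 s) i)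
    = cost_after A pre s by rewrite -gen.
elim: s pre => [|x s IH] pre /=; first by rewrite big_ord0.
rewrite big_ord_recl /= cats0 take0 cats1; congr (_ + _).
by rewrite -IH; apply: eq_bigr => t _; apply: eq_bigr => i _; rewrite !cat_rcons.
Qed.

Lemma cost_after_ge0 A pre s : 0 <= cost_after A pre s.
Proof.
elim: s pre => //= x s IH pre; rewrite addr_ge0 // sumr_ge0 // => i _.
exact: mdist_ge0.
Qed.

(** [lag] is a potential: real moves raise it by at most their length, and its fall pays for the
    hole. So the algorithm may move several servers at once and leave the chosen points. *)
Lemma value_le_cost (A : seq M -> config) (a : adversary R T) Q :
  (forall pre x, exists i, A (rcons pre x) i = x) ->
  fair_on Q a -> forall pre f u, shadow f u ->
  value d [set: T]%SET a (fun=> 0) u <=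
    mean a (fun s => cost_after A pre (map p s)) + lag (A pre) f.
Proof.
move=> Aserve; elim: a => /= [_|x a IH [_ fa]|q a1 IH1 a2 IH2 [/andP[q0 q1] f1 f2]] pre f u fu.
- by rewrite add0r lag_ge0.
- have [f' [u' [fu' u'x uu' lagle]]] := shadow_serve fu (Aserve pre (p x)).
  rewrite meanD mean_cst.
  have := IH fa (rcons pre (p x)) f' u' fu'.
  have := lag_move (A pre) (A (rcons pre (p x))) f.
  have vle : (if u == x then nearest d [set: T]%SET x (value d [set: T]%SET a (fun=> 0)) x
     else value d [set: T]%SET a (fun=> 0) u) <= value d [set: T]%SET a (fun=> 0) u' + d u u'.
    have [ux|ux] := eqVneq u x.
      rewrite ux (dist_sym point_dist_metric); apply: (nearest_le d (value d [set: T]%SET a (fun=> 0))).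
      by rewrite !inE u'x.
    by rewrite uu' // (dist_xx point_dist_metric) addr0.
  move=> H2 H1; apply: le_trans vle _; lra.
- have r0 : 0 <= 1 - q by lra.
  have := ler_wpM2l q0 (IH1 f1 pre f u fu); have := ler_wpM2l r0 (IH2 f2 pre f u fu); lra.
Qed.

(** A move of the hole from [h] to [g] is the server at [g] moving to [h]; if no server stands at
    [g], nothing moves. *)
Lemma offline_schedule s h h' f : (1 < #|[set: T]%SET|)%N -> shadow f h ->
  exists S : nat -> config, [/\ S 0%N = p \o f,
    forall t x, onth (map p s) t = Some x -> exists i, S t.+1 i = x &
    movement_cost (size s) S <= offline d [set: T]%SET s h h'].
Proof.
move=> T1; elim: s h f => [|x s IH] h f fh.
  exists (fun=> p \o f); split=> //=; first by case.
  by rewrite /movement_cost big_ord0; exact: mdist_ge0.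
have /= [g] := nearestP d x (fun g => offline d [set: T]%SET s g h') h T1.
rewrite !inE andbT => gx gE.
have [[finj fhole]] := (fh, fh).
move=> _; have fg := shadow_swap h g fh; rewrite tpermL in fg.
have [S [S0 Sserve Scost]] := IH g _ fg.
exists (fun t => if t is t'.+1 then S t' else p \o f); split=> //.
- case=> [|t] y /=; last exact: Sserve.
  move=> [<-]; have [|i fi] := shadow_onto (x := x) fg; first by rewrite eq_sym.
  by exists i; rewrite S0 /= -fi.
rewrite /movement_cost big_ord_recl /= gE addrC lerD //.
rewrite S0 /=.
have [[j fj]|ng] := pselect (exists j, f j = g).
  rewrite (bigD1 j) //= fj tpermR big1 ?addr0 // => i ij.
  rewrite tpermD ?mdistxx // 1?eq_sym //.
  by rewrite -fj (inj_eq finj).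
rewrite big1; first exact: mdist_ge0.
move=> i _; rewrite tpermD ?mdistxx // 1?eq_sym //.
by apply/negP => /eqP fi; apply: ng; exists i.
Qed.

Lemma cost_opt_le (x0 : config) s h h' f : (1 < #|[set: T]%SET|)%N -> shadow f h ->
  cost_opt x0 (map p s) <= offline d [set: T]%SET s h h' + lag x0 f.
Proof.
move=> T1 fh; have [S [S0 Sserve Scost]] := offline_schedule s h' T1 fh.
pose S' t := if t is t'.+1 then S t'.+1 else x0.
apply: le_trans (_ : movement_cost (size s) S' <= _).
  rewrite /cost_opt; apply: ge_inf.
    exists 0 => _ [S'' _ <-]; apply: sumr_ge0 => t _; apply: sumr_ge0 => i _.
    exact: mdist_ge0.
  exists S'; last by rewrite size_map.
  by split=> // t x /Sserve.
apply: le_trans (lerD Scost (lexx _)).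
rewrite /movement_cost; case: (size s) => [|k]; first by rewrite !big_ord0 add0r lag_ge0.
rewrite !big_ord_recl /= addrAC lerD2r /lag -big_split; apply: ler_sum => i _ /=.
by rewrite S0 addrC; exact: metric_triangle.
Qed.

End Servers.

(** * Randomized algorithms *)

Section Competitive.
Context {R : realType}.

(** Exchanges the averages over adversary and algorithm. The tree being finite, linearity of the
    integral of nonnegative functions suffices, with measurability carried along the induction. *)
Lemma mean_integral (d : measure_display) (T0 : measurableType d) (P : probability T0 R)
    (X : Type) (Q : X -> Prop) (a : adversary R X) (F : T0 -> seq X -> R) (B : seq X -> R) :
  fair_on Q a -> (forall s, measurable_fun [set: T0] (F^~ s)) -> (forall w s, 0 <= F w s) ->
  (forall s, (\int[P]_w (F w s)%:E <= (B s)%:E)%E) ->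
  measurable_fun [set: T0] (fun w => mean a (F w)) /\
  (\int[P]_w (mean a (F w))%:E <= (mean a B)%:E)%E.
Proof.
elim: a F B => /= [|x a IH|q a1 IH1 a2 IH2] F B.
- by move=> _ mF F0 FB; split; [exact: mF|exact: FB].
- by move=> [_ fa] mF F0 FB; apply: IH.
move=> [/andP[q0 q1] f1 f2] mF F0 FB.
have [m1 i1] := IH1 F B f1 mF F0 FB; have [m2 i2] := IH2 F B f2 mF F0 FB.
have r0 : 0 <= 1 - q by rewrite subr_ge0.
have mean_ge0 (a : adversary R X) w : fair_on Q a -> 0 <= mean a (F w).
  by move=> fa; rewrite -(mean_cst a 0); apply: (le_mean fa) => s; exact: F0.
have mq (c : R) g : measurable_fun [set: T0] g -> measurable_fun [set: T0] (fun w => c * g w).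
  by move=> mg; apply: measurable_funM.
split; first by apply: measurable_funD; exact: mq.
rewrite (eq_integral (fun w => q%:E * (mean a1 (F w))%:E + (1 - q)%:E * (mean a2 (F w))%:E)%E); last first.
  by move=> w _; rewrite EFinD !EFinM.
rewrite ge0_integralD //.
- rewrite !ge0_integralZl_EFin //.
  + have -> : ((q * mean a1 B + (1 - q) * mean a2 B)%:E =
        q%:E * (mean a1 B)%:E + (1 - q)%:E * (mean a2 B)%:E)%E by rewrite -!EFinM -EFinD.
    by rewrite leeD // lee_wpmul2l // lee_fin.
  + by move=> w _; rewrite lee_fin mean_ge0.
  + exact/measurable_EFinP.
  + by move=> w _; rewrite lee_fin mean_ge0.
  + exact/measurable_EFinP.
- by move=> w _; rewrite -EFinM lee_fin mulr_ge0 // mean_ge0.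
- by apply/measurable_EFinP; exact: mq.
- by move=> w _; rewrite -EFinM lee_fin mulr_ge0 // mean_ge0.
- by apply/measurable_EFinP; exact: mq.
Qed.

Lemma cost_opt_ge0 (M : metricType R) (K : nat) (x0 : config M K) s : 0 <= cost_opt x0 s.
Proof.
rewrite /cost_opt; set E := (X in inf X).
have [->|E0] := eqVneq E classical_sets.set0; first by rewrite inf0.
apply: lb_le_inf; first exact/set0P.
move=> _ [S _ <-]; apply: sumr_ge0 => t _; apply: sumr_ge0 => i _.
exact: mdist_ge0.
Qed.

(** The inequality [key] holds for every budget; as [eps] grows the additive terms [c'] and [c1]
    become negligible, which rules out [m < rho]. *)
Lemma competitive_ge (M : metricType R) (K : nat) (p : 'I_K.+1 -> M)
    (x0 : config M K) (d : measure_display) (T0 : measurableType d) (P : probability T0 R)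
    (A : T0 -> seq M -> config M K) (r rho e : R) (Z : {set 'I_K.+1}) (h : 'I_K.+1) :
  injective p -> is_randomized_algorithm x0 A -> competitive P x0 A r ->
  0 < rho -> ratio_on (point_dist p) Z h rho e -> rho <= r.
Proof.
move=> p_inj [online mA] [c' comp] rho0 [Z1 rZ].
have dM := point_dist_metric p_inj.
have [d0 d0_gt0 d0_lt] := dist_lower_bound dM.
have [D D0 D_ge] := dist_upper_bound dM.
pose L := (Num.truncn (3 * D / d0)).+1.
have L_ge : 3 * D <= d0 *+ L.
  by rewrite -[leRHS]mulr_natl -ler_pdivrMr // ltW // truncnS_gt.
have d0_le x y : x != y -> d0 <= point_dist p x y by move=> /d0_lt/ltW.
have T1 : (1 < #|[set: 'I_K.+1]%SET|)%N.
  by rewrite cardsT; apply: leq_trans Z1 _; exact: max_card.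
pose f : 'I_K -> 'I_K.+1 := lift h.
have fh : shadow f h.
  by split; [exact: lift_inj|move=> i; rewrite eq_sym neq_lift].
pose c1 := lag p x0 f.
have c10 : 0 <= c1 by exact: lag_ge0.
have serve w pre x : exists i, A w (rcons pre x) i = x.
  have [_ /(_ (size pre) x)] := online w (rcons pre x).
  rewrite /online_schedule take_oversize ?size_rcons //; apply.
  by rewrite onthE map_rcons nth_rcons size_map ltnn eqxx.
have start w : A w [::] = x0 by have [] := online w [::].
(* [r] might be negative, and then an upper bound on the offline cost could not be multiplied by
   it. *)
pose m := Num.max r 0.
have m0 : 0 <= m by rewrite le_max lexx orbT.
have key eps : 0 < eps -> rho * eps <= m * (eps + c1) + c' + c1.
  move=> eps0; have [a [hZ fa Da Fa]] := rZ eps eps0.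
  pose aT := expand (fun x => requests (cycle Z L x)) a.
  have faT : fair_on (fun _ => True) aT.
    apply: fair_on_expand fa => x _; elim: (cycle Z L x) => //= y s IH; split=> //.
  have v1 : rho * eps <= value (point_dist p) [set: 'I_K.+1]%SET aT (fun=> 0) h.
    have [/(_ h hZ) + _] := expand_value dM Z1 d0_gt0 d0_le D_ge L_ge fa.
    (* With ambient set [Z] there is nowhere to leave to, so the exit condition is vacuous. *)
    apply: le_trans; rewrite -[leLHS]add0r; apply: Fa => // x u _ uZ.
    by rewrite uZ.
  pose F w (s : seq 'I_K.+1) := cost_alg (A w) (map p s).
  have F0 w s : 0 <= F w s by rewrite /F cost_alg_after cost_after_ge0.
  have v2 w : rho * eps - c1 <= mean aT (F w).
    have := value_le_cost p_inj (serve w) faT [::] fh; rewrite start -/c1.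
    rewrite (eq_mean _ (fun s => esym (cost_alg_after (A w) (map p s)))) => v3.
    by rewrite lerBlDr; exact: le_trans v3.
  have FB s : (\int[P]_w (F w s)%:E <= (r * cost_opt x0 (map p s) + c')%:E)%E.
    by have := comp (map p s); rewrite unlock.
  have [mm im] := mean_integral faT (fun s => mA (map p s)) F0 FB.
  have v3 : rho * eps - c1 <= mean aT (fun s => r * cost_opt x0 (map p s) + c').
    rewrite -lee_fin; apply: le_trans im.
    have mF0 w : 0 <= mean aT (F w).
      by rewrite -(mean_cst aT 0); apply: (le_mean faT) => s; exact: F0.
    have [neg|pos] := leP (rho * eps - c1) 0.
      apply: le_trans (_ : 0%:E <= _)%E; first by rewrite lee_fin.
      by apply: integral_ge0 => w _; rewrite lee_fin mF0.
    rewrite -[leLHS]mule1 -(probability_setT P) -integral_cst //.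
    apply: ge0_le_integral => //.
    - by move=> w _; rewrite lee_fin ltW.
    - exact/measurable_EFinP.
    - by move=> w _; rewrite lee_fin v2.
  have opt_le : mean aT (fun s => cost_opt x0 (map p s)) <= eps + c1.
    have h1 : mean aT (fun s => cost_opt x0 (map p s)) <=
        mean aT (fun s => offline (point_dist p) [set: 'I_K.+1]%SET s h h + c1).
      apply: (le_mean faT) => s; exact: cost_opt_le.
    apply: le_trans h1 _; rewrite meanD mean_cst lerD2r.
    apply: le_trans (Da Z (fintype.subxx _) Z1).
    rewrite mean_expand /mean_offline; apply: (le_mean fa) => s.
    by rewrite mean_play_requests; exact: offline_cycle.
  have opt_ge0 : 0 <= mean aT (fun s => cost_opt x0 (map p s)).
    by rewrite -(mean_cst aT 0); apply: (le_mean faT) => s; exact: cost_opt_ge0.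
  rewrite meanD meanZ mean_cst in v3.
  have rm : r * mean aT (fun s => cost_opt x0 (map p s)) <= m * (eps + c1).
    apply: (le_trans (ler_wpM2r opt_ge0 (_ : r <= m))); first by rewrite le_max lexx.
    exact: ler_wpM2l m0 _ _ opt_le.
  lra.
rewrite leNgt; apply/negP => r_lt.
have m_lt : m < rho by rewrite gt_max r_lt.
have rm0 : 0 < rho - m by rewrite subr_gt0.
pose C := m * c1 + c' + c1.
have eps0 : 0 < (`|C| + 1) / (rho - m) by rewrite divr_gt0 // ltr_wpDl.
have := key _ eps0.
have : (rho - m) * ((`|C| + 1) / (rho - m)) = `|C| + 1 by field; rewrite gt_eqF.
have := ler_norm C; rewrite /C; lra.
Qed.

Lemma overhead_le (N k : nat) :
  (0 < N)%N -> 1 + ln N%:R <= 2 ^+ k :> R -> 2 * overhead N <= 2 ^+ (19 + (k + k)) :> R.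
Proof.
rewrite /overhead => N0; move Ex : (1 + ln N%:R) => x xk.
have x0 : 0 <= x by rewrite -Ex addr_ge0 // ln_ge0 // ler1n.
have c9 : 400 <= 2 ^+ 9 :> R by rewrite -natrX ler_nat.
have x400 : 0 <= 400 * x := mulr_ge0 (ler0n R 400) x0.
have xx : 400 * x <= 2 ^+ (9 + k).
  by rewrite exprD; exact: (ler_pM (ler0n R 400) x0 c9 xk).
have -> : (19 + (k + k) = 1 + ((9 + k) + (9 + k)))%N by lia.
rewrite exprD expr1 exprD expr2.
exact: (ler_wpM2l (ler0n R 2) (ler_pM x400 x400 xx xx)).
Qed.

End Competitive.

(** * Choice of the constants *)

Local Open Scope classical_set_scope.
Local Open Scope ring_scope.

Theorem theorem6p2 (R : realType) :
  exists (c : R) (K0 : nat), 0 < c /\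
    forall (K : nat), (K0 <= K)%N ->
    forall (M : metricType R), ([set: 'I_K.+1] #<= [set: M])%card ->
    forall (x0 : config M K)
           (d : measure_display) (T : measurableType d) (P : probability T R)
           (A : T -> seq M -> config M K) (r : R),
      is_randomized_algorithm x0 A ->
      competitive P x0 A r ->
      c * (ln K%:R / ln (ln K%:R) ^+ 2) <= r.
Proof.
have rate_gt0 : 0 < rate :> R by rewrite invr_gt0 mulr_gt0.
(* This [K0] makes [ln (ln K)] at least 1. The 58 is twice the 29 in [h <= 29 * LL ^ 2], the factor
   2 being that of [2 * h] in [metric_hard]. *)
exists (rate / 58), (Num.truncn (expR (expR 1) : R)).+1; split; first by rewrite divr_gt0.
move=> K K_ge M KM x0 d T P A r rand comp.
have [p p_inj] : exists p : 'I_K.+1 -> M, injective p.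
  have /card_leP[f] := KM; exists (fun i => \val (f (to_setT i))) => i j /val_inj fij.
  exact: (congr1 val (@inj _ _ _ f _ _ (in_setT _) (in_setT _) fij)).
have K_gt : expR (expR 1) < K%:R :> R.
  by apply: lt_le_trans (truncnS_gt _) _; rewrite ler_nat.
have K0 : 0 < K%:R :> R by apply: lt_trans K_gt; exact: expR_gt0.
have lnK_gt : expR 1 < ln K%:R :> R by rewrite -ltr_expR lnK ?posrE.
have e2 : 2 <= expR 1 :> R by have := expR_ge1Dx (1 : R); lra.
have lnK2 : 2 <= ln K%:R :> R by lra.
have lnK0 : 0 < ln K%:R :> R by lra.
set LL := ln (ln K%:R : R).
have LL1 : 1 <= LL.
  by rewrite /LL -ler_expR lnK ?posrE; lra.
have N0 : 0 < K.+1%:R :> R by rewrite ltr0n.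
have lnKN : ln K%:R <= ln K.+1%:R :> R by rewrite ler_ln ?posrE // ler_nat.
have lnN_le : ln K.+1%:R <= ln K%:R + 1 :> R.
  have : ln K.+1%:R <= ln (2 * K%:R) :> R.
    rewrite ler_ln ?posrE ?mulr_gt0 // -natr1.
    have : 1 <= K%:R :> R by rewrite ler1n; rewrite ltr0n in K0.
    lra.
  rewrite lnM ?posrE //; have := @ln2_le1 R; lra.
pose x : R := 1 + ln K.+1%:R.
have x0' : 0 < x by rewrite /x; lra.
have lnx : ln x <= 2 * LL.
  have -> : 2 * LL = ln (ln K%:R ^+ 2) by rewrite lnXn ?mulr_natl //; lra.
  rewrite ler_ln ?posrE ?exprn_gt0 //.
  rewrite /x expr2.
  have : 0 <= (ln K%:R - 2) * (ln K%:R + 1) :> R by rewrite mulr_ge0; lra.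
  lra.
have lnx0 : 0 <= ln x by rewrite ln_ge0 // /x; lra.
(* The factor 2 offsets the lower bound one half for [ln 2], so that [x <= 2 ^ k]. *)
pose k := (Num.truncn (2 * ln x)).+1.
have k_gt : 2 * ln x <= k%:R by rewrite ltW // truncnS_gt.
have k_le : k%:R <= 2 * ln x + 1.
  have /truncn_itv/andP[+ _] : 0 <= 2 * ln x by rewrite mulr_ge0.
  by rewrite -[k%:R]natr1 lerD2r.
clearbody k.
(* In fact [19 + 2 * k <= 21 + 8 * LL <= 29 * LL]; a factor [LL] is given away to match the
   claim. *)
have h_le : (19 + (k + k))%:R <= 29 * LL ^+ 2.
  rewrite !natrD; have : LL <= LL ^+ 2 by rewrite expr2 ler_peMr // (le_trans _ LL1).
  lra.
have xk : x <= 2 ^+ k.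
  rewrite -ler_ln ?posrE ?exprn_gt0 // lnXn // -[ln 2 *+ k]mulr_natr.
  have k0 : 0 <= k%:R :> R by [].
  have := ler_wpM2r k0 (@ln2_ge_half R); lra.
pose h := (19 + (k + k))%N.
have h0 : (0 < h)%N by [].
have h_large : 2 * overhead #|'I_K.+1| <= 2 ^+ h :> R.
  by rewrite card_ord; exact: overhead_le.
have hR : 0 < h%:R :> R by rewrite ltr0n.
have {}h_le : h%:R <= 29 * LL ^+ 2 := h_le.
clearbody h.
have T1 : (1 < #|'I_K.+1|)%N by rewrite card_ord ltnS; rewrite ltr0n in K0.
have [n [e [[u [Z [_ _ n0 rZ]]] n_ge]]] := metric_hard (point_dist_metric p_inj) h0 h_large T1.
rewrite card_ord in n_ge; clear h_large.
have lnn : 0 < ln n%:R :> R.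
  apply: lt_le_trans n_ge; apply: divr_gt0; first exact: lt_le_trans lnK0 lnKN.
  exact: mulr_gt0.
have n1 : (1 < n)%N.
  by rewrite ltn_neqAle n0 andbT; apply: contraTneq lnn => <-; rewrite ln1 ltxx.
have rho0 : 0 < rate * ln n%:R :> R by rewrite mulr_gt0.
apply: le_trans (competitive_ge p_inj rand comp rho0 (rZ n1)).
rewrite -mulrA ler_pM2l //; apply: le_trans n_ge.
have LL2 : 0 < LL ^+ 2 by rewrite exprn_gt0 //; lra.
rewrite ler_pdivlMr; last exact: mulr_gt0.
apply: le_trans lnKN; have {2}-> : ln K%:R = 58^-1 * (ln K%:R / LL ^+ 2) * (58 * LL ^+ 2).
  by field; rewrite gt_eqF //; lra.
apply: ler_wpM2l; last lra.
by apply: mulr_ge0; [rewrite invr_ge0|exact: divr_ge0 (ltW lnK0) (ltW LL2)].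
Qed.
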